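(* The following three integral evaluations hold: $$\int_0^1 \mathbf{E}\left(\sqrt{1-x}\right)\, \mathbf{K}^2\left(\sqrt{\frac{1-\sqrt{1-x}}{2}}\right) dx = \frac{\pi^3 (1+4\ln 2)}{32},$$ $$\int_0^1 \mathbf{E}\left(\sqrt{1-x}\right)\, \mathbf{K}^2\left(\sqrt{\frac12 - \frac12\sqrt{1-\frac{x}{2}}}\right) dx = \frac{\pi^2 (4G + 2 + \pi \ln 2)}{16\sqrt2},$$ $$\int_0^1 \mathbf{E}\left(\sqrt{1-x}\right)\, \mathbf{K}^2\left(\sqrt{\frac12 - \frac{\sqrt{4+x}}{4}}\right) dx = \frac{\pi^2}{2}\left(\frac{\pi^2}{20} + \frac{3\ln\phi}{2} - \frac{\sqrt5}{4}\right).$$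
   Context: The complete elliptic integrals of the first and second kind, as functions of the modulus $k$, are $\mathbf{K}(k) = \int_0^{\pi/2} (1 - k^2\sin^2\theta)^{-1/2}\, d\theta$ and $\mathbf{E}(k) = \int_0^{\pi/2} \sqrt{1-k^2\sin^2\theta}\, d\theta$; they depend only on $k^2$, so they are also defined (by the same integrals) when $k$ is purely imaginary, i.e. $k^2<0$. $\mathbf{K}^2(\cdot)$ denotes the square of $\mathbf{K}(\cdot)$. $G = 1 - \frac{1}{3^2} + \frac{1}{5^2} - \cdots$ is Catalan's constant and $\phi = \frac{1+\sqrt5}{2}$ is the golden ratio. *)

(* Defs.v *)
From Stdlib Require Import Reals Lra.
From Coquelicot Require Import Coquelicot.

Open Scope R_scope.

(* The modulus k is either purely imaginary or real with |k| < 1 (|k| <= 1 for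
   [ellipticE]), so k ^ 2 is real and [Re (k ^ 2)] is k ^ 2 itself. For any
   other k : C the two functions below are junk values. *)
Definition ellipticK (k : C) : R :=
  RInt (fun theta => / sqrt (1 - Re (k ^ 2)%C * sin theta ^ 2)) 0 (PI / 2).

Definition ellipticE (k : C) : R :=
  RInt (fun theta => sqrt (1 - Re (k ^ 2)%C * sin theta ^ 2)) 0 (PI / 2).

(* Principal square root of a real number: real for 0 <= x, on the positive
   imaginary axis for x < 0 (whereas Stdlib's [sqrt] is 0 there). *)
Definition csqrt (x : R) : C :=
  if Rle_dec 0 x then (sqrt x, 0) else (0, sqrt (- x)).

Lemma csqrt_sqr (x : R) : (csqrt x ^ 2)%C = RtoC x.
Proof.
unfold csqrt; destruct (Rle_dec 0 x) as [Hx | Hx]; rewrite Cpow_S, Cpow_1_r;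
  unfold Cmult, RtoC; simpl; apply f_equal2; try ring.
- rewrite sqrt_sqrt by lra; ring.
- rewrite sqrt_sqrt by lra; ring.
Qed.

Definition catalanG : R := Series (fun n => (-1) ^ n / INR (2 * n + 1) ^ 2).

Definition golden_ratio : R := (1 + sqrt 5) / 2.

(* Main.v *)
Require Import Defs.
From Stdlib Require Import Reals Lra Lia.
From Coquelicot Require Import Coquelicot.

Open Scope R_scope.

(** Write [a_n = cbin n] for the binomial coefficient of [2n] over [n] divided by [4^n].  By
    Clausen's formula (lemma [ellipticK_sqr_series]) the squares of K in the three integrands
    are [PI^2 / 4] times the series [sum a_n^3 (z x)^n] with [z = 1], [1/2] and [-1/4].  The
    moments of the other factor have a closed form ([is_RInt_ellipticE_moment]):
    the integral over [[0, 1]] of [x^n E(sqrt (1 - x))] is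
    [4 (n+1) / ((2n+1)^2 (2n+3) a_n^2)].  As [sum a_n^3] converges, termwise integration is
    allowed, and each integral equals [PI^2 sum a_n z^n (n+1) / ((2n+1)^2 (2n+3))]
    ([is_RInt_ellipticE_K_sqr]).

    Clausen's formula needs two facts.  The series [sum a_n^2 m^n] of K equals
    [sum c_n (4 m (1 - m))^n], where [c_n] are the coefficients of 2F1(1/4, 1/4; 1; .), because
    both sides are regular at 0 and solve the same Legendre equation, whose regular solution is
    unique by a contraction argument.  The Cauchy square of [c_n] is [a_n^3], because a
    telescoping certificate shows that both sequences satisfy the same recursion of order one.

    The moments come from the expansion of E in powers of [1 - x]: their recursion in [n] is
    again a telescoping sum, and it starts from [E(1) = 1].

    By partial fractions the remaining series is, for [z = 1], [1/2] or [-1/4], an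
    elementary term plus a multiple of the integral of [t cot t] over [[0, PI/2]] or
    [[0, PI/4]], or of [t coth t] over [[0, ln phi]] ([reduced_series]); this is the arcsine
    expansion of [t] in powers of [sin t] (or [sinh t]), integrated term by term.  The
    cotangent integrals are computed from the symmetries [t -> 2t] and [t -> PI/2 - t] and from
    the Gregory series, which brings in Catalan's constant ([cot_integrals]).  The hyperbolic
    integral is [PI^2 / 12 - Li2(phi^-2) / 2 - (ln phi)^2 / 2]; three functional equations of
    the dilogarithm Li2, combined in [dilog_three_terms], meet at [1 / phi] and give
    [Li2(phi^-2) = PI^2 / 15 - (ln phi)^2].  The value [Li2(1) = PI^2 / 6] that they require
    is Euler's, once more from the arcsine expansion. *)

(** * Series and termwise integration *)

Lemma ex_series_Rabs_le (u M : nat -> R) :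
  (forall n, Rabs (u n) <= M n) -> ex_series M -> ex_series (fun n => Rabs (u n)).
Proof.
intros Hu HM.
apply (ex_series_le (K := R_AbsRing) (V := R_CompleteNormedModule)) with M; auto.
intros n; change (Rabs (Rabs (u n)) <= M n); rewrite Rabs_Rabsolu; auto.
Qed.

Lemma ex_series_dominated (u M : nat -> R) :
  (forall n, Rabs (u n) <= M n) -> ex_series M -> ex_series u.
Proof. intros Hu HM; apply ex_series_Rabs, (ex_series_Rabs_le u M); auto. Qed.

Lemma is_series_ext_R (u v : nat -> R) (l : R) :
  (forall n, u n = v n) -> is_series u l -> is_series v l.
Proof. apply is_series_ext. Qed.

Lemma sum_n_telescope (u v : nat -> R) :
  (forall n, u n = v (S n) - v n) -> forall N, sum_n u N = v (S N) - v 0%nat.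
Proof.
intros H N; induction N as [|N IH].
- rewrite sum_O; apply H.
- rewrite sum_Sn, IH, (H (S N)); unfold plus; simpl; ring.
Qed.

Lemma is_series_telescope (u v : nat -> R) (l : R) :
  (forall n, u n = v (S n) - v n) -> is_lim_seq v l -> is_series u (l - v 0%nat).
Proof.
intros H Hv.
change (is_lim_seq (sum_n u) (l - v 0%nat)).
apply is_lim_seq_ext with (fun n => v (S n) - v 0%nat).
- intros n; symmetry; now apply sum_n_telescope.
- apply is_lim_seq_minus'; [ | apply is_lim_seq_const].
  now apply (proj1 (is_lim_seq_incr_1 v l)).
Qed.

Lemma ex_series_telescope (u v : nat -> R) :
  (forall n, 0 <= v n) -> (forall n, 0 <= u n <= v n - v (S n)) -> ex_series u.
Proof.
intros Hv Hu.
destruct (ex_finite_lim_seq_decr v 0) as [l Hl]; auto.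
{ intros n; specialize (Hu n); lra. }
apply (ex_series_dominated u (fun n => - v (S n) - - v n)).
- intros n; rewrite Rabs_pos_eq; specialize (Hu n); lra.
- eexists; apply (is_series_telescope _ (fun n => - v n) (- l)); auto.
  now apply (is_lim_seq_opp v l).
Qed.

(** Weierstrass M-test: the tails of [M] bound the remainders at all points at once. *)
Lemma Series_uniform (u : nat -> R -> R) (M : nat -> R) :
  (forall n x, Rabs (u n x) <= M n) -> ex_series M -> forall eps : posreal,
  exists N0, forall N x, (N0 <= N)%nat ->
    Rabs (sum_n (fun n => u n x) N - Series (fun n => u n x)) < eps.
Proof.
intros Hw [S0 HS] eps.
pose proof (proj1 (filterlim_locally _ _) HS eps) as [N0 HN0].
exists N0; intros N x HN.
specialize (HN0 N HN).
assert (HM : ex_series M) by now exists S0.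
assert (Ha : ex_series (fun n => Rabs (u n x))) by (apply ex_series_Rabs_le with M; auto).
assert (He := ex_series_Rabs _ Ha).
assert (Htail : forall f : nat -> R, ex_series f ->
          Series f - sum_n f N = Series (fun k => f (S N + k)%nat)).
{ intros f Hf; rewrite (Series_incr_n f (S N)); auto; [ | lia].
  simpl pred; rewrite <- sum_n_Reals; ring. }
rewrite Rabs_minus_sym, Htail by auto.
apply Rle_lt_trans with (Series (fun k => Rabs (u (S N + k)%nat x))).
{ apply Series_Rabs; apply (ex_series_incr_n (fun k => Rabs (u k x))); auto. }
apply Rle_lt_trans with (Series (fun k => M (S N + k)%nat)).
{ apply Series_le.
  - intros n; split; [apply Rabs_pos | apply Hw].
  - now apply (ex_series_incr_n M). }
rewrite <- Htail by auto.
rewrite (is_series_unique _ _ HS).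
change (Rabs (sum_n M N - S0) < eps) in HN0.
rewrite Rabs_minus_sym in HN0.
apply Rle_lt_trans with (2 := HN0); apply Rle_abs.
Qed.

Lemma continuity_pt_Series (u : nat -> R -> R) (M : nat -> R) (x : R) :
  (forall n y, Rabs (u n y) <= M n) -> ex_series M ->
  (forall n y, continuity_pt (u n) y) -> continuity_pt (fun y => Series (fun n => u n y)) x.
Proof.
intros Hu HM Hc.
apply (CVU_continuity (fun N y => sum_n (fun n => u n y) N) _ x (mkposreal 1 Rlt_0_1)).
- intros eps Heps; destruct (Series_uniform u M Hu HM (mkposreal eps Heps)) as [N0 HN0].
  exists N0; intros N y HN _; rewrite Rabs_minus_sym; now apply HN0.
- intros N y _; induction N as [|N IH].
  + apply continuity_pt_ext with (u 0%nat); auto; intros t; now rewrite sum_O.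
  + apply continuity_pt_ext with (fun t => sum_n (fun n => u n t) N + u (S N) t).
    * intros t; now rewrite sum_Sn.
    * now apply continuity_pt_plus.
- unfold Boule; rewrite Rminus_diag, Rabs_R0; simpl; lra.
Qed.

(** The terms are set to 0 outside the open interval, because the passage to the limit under
    the integral asks for uniform convergence on the whole line. *)
Lemma is_RInt_Series (u : nat -> R -> R) (M l : nat -> R) (a b : R) :
  a < b ->
  (forall n, is_RInt (u n) a b (l n)) ->
  (forall n x, a < x < b -> Rabs (u n x) <= M n) ->
  ex_series M ->
  ex_series l /\ is_RInt (fun x => Series (fun n => u n x)) a b (Series l).
Proof.
intros Hab Hu HuM HM.
set (inside := fun x => if Rlt_dec a x then if Rlt_dec x b then true else false else false).
assert (Hin : forall x, a < x < b -> inside x = true).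
{ intros x Hx; unfold inside.
  destruct (Rlt_dec a x); [ | lra]; destruct (Rlt_dec x b); auto; lra. }
assert (Hin' : forall x, inside x = true -> a < x < b).
{ intros x; unfold inside.
  destruct (Rlt_dec a x); [ | discriminate]; destruct (Rlt_dec x b); auto; discriminate. }
assert (Hminmax : Rmin a b = a /\ Rmax a b = b).
{ split; [apply Rmin_left | apply Rmax_right]; lra. }
destruct Hminmax as [Hmin Hmax].
set (w := fun n x => if inside x then u n x else 0).
assert (Hw : forall n x, Rabs (w n x) <= M n).
{ intros n x; unfold w; destruct (inside x) eqn:E.
  - apply HuM; auto.
  - rewrite Rabs_R0.
    apply Rle_trans with (2 := HuM n ((a + b) / 2) ltac:(lra)); apply Rabs_pos. }
assert (Hpart : forall N, is_RInt (fun x => sum_n (fun n => w n x) N) a b (sum_n l N)).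
{ intros N; apply (is_RInt_ext (fun x => sum_n (fun n => u n x) N)).
  - intros x Hx; rewrite Hmin, Hmax in Hx.
    apply sum_n_ext; intros n; unfold w; now rewrite Hin.
  - induction N as [|N IH].
    + apply is_RInt_ext with (u 0%nat); [ | rewrite sum_O; apply Hu].
      intros x _; now rewrite sum_O.
    + rewrite sum_Sn.
      apply is_RInt_ext with (fun x => plus (sum_n (fun n => u n x) N) (u (S N) x)).
      * intros x _; now rewrite sum_Sn.
      * apply (is_RInt_plus (V := R_NormedModule)); auto. }
assert (Hlim : filterlim (fun N x => sum_n (fun n => w n x) N) eventually
                 (locally ((fun x => Series (fun n => w n x)) : fct_UniformSpace R R_UniformSpace))).
{ apply (filterlim_locally (F := eventually) (U := fct_UniformSpace R R_UniformSpace)).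
  intros eps; destruct (Series_uniform w M Hw HM eps) as [N0 HN0].
  exists N0; intros N HN x.
  change (Rabs (sum_n (fun n => w n x) N - Series (fun n => w n x)) < eps).
  now apply HN0. }
destruct (filterlim_RInt (V := R_CompleteNormedModule) _ a b eventually _ _ _ Hpart Hlim)
  as [I [HI1 HI2]].
assert (HI : is_series l I) by exact HI1.
split; [now exists I | ].
rewrite (is_series_unique _ _ HI).
apply is_RInt_ext with (2 := HI2).
intros x Hx; rewrite Hmin, Hmax in Hx.
apply Series_ext; intros n; unfold w; now rewrite Hin.
Qed.

Lemma is_RInt_ext_open (f g : R -> R) (a b l : R) :
  a < b -> (forall x, a < x < b -> f x = g x) -> is_RInt f a b l -> is_RInt g a b l.
Proof.
intros Hab H; apply is_RInt_ext; intros x.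
rewrite Rmin_left, Rmax_right by lra; apply H.
Qed.

Lemma is_RInt_ext_all (f g : R -> R) (a b l : R) :
  (forall x, f x = g x) -> is_RInt f a b l -> is_RInt g a b l.
Proof. intros H; apply is_RInt_ext; intros x _; apply H. Qed.

Lemma is_RInt_value (f : R -> R) (a b l l' : R) : l = l' -> is_RInt f a b l -> is_RInt f a b l'.
Proof. now intros ->. Qed.

Lemma pow_unit_interval x n : 0 <= x <= 1 -> 0 <= x ^ n <= 1.
Proof.
intros Hx; split; [apply pow_le; lra | ].
rewrite <- (pow1 n); apply pow_incr; lra.
Qed.

(** * Power series and primitives *)

Lemma CV_radius_bounded_ge (a : nat -> R) (C x : R) :
  (forall n, Rabs (a n) <= C) -> Rabs x < 1 -> Rbar_lt (Rabs x) (CV_radius a).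
Proof.
intros Ha Hx.
apply Rbar_lt_le_trans with 1; auto.
apply (proj1 (CV_radius_bounded a)).
exists C; intros n; rewrite pow1, Rmult_1_r; auto.
Qed.

Lemma is_derive_continuity_pt (f : R -> R) (x l : R) : is_derive f x l -> continuity_pt f x.
Proof.
intros H; apply continuity_pt_filterlim, (ex_derive_continuous (V := R_NormedModule)).
now exists l.
Qed.

Lemma constant_of_derive_0 (f : R -> R) (a b : R) :
  (forall x, Rmin a b <= x <= Rmax a b -> is_derive f x 0) -> f b = f a.
Proof.
intros H.
destruct (MVT_gen f a b (fun _ => 0)) as [c [_ Hc]].
- intros x Hx; apply H; lra.
- intros x Hx; apply is_derive_continuity_pt with 0; auto.
- lra.
Qed.

(** Fundamental theorem with a possibly singular left end point: the usual one applies on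
    [[x, b]], and since [g] is bounded the integral over [[a, x]] tends to 0 with [x - a]. *)

Lemma is_RInt_derive_open_left (f g : R -> R) (a b C X : R) :
  a < b ->
  (forall x, a < x <= b -> is_derive f x (g x)) ->
  (forall x, a < x <= b -> continuous g x) ->
  (forall x, a < x < b -> Rabs (g x) <= C) ->
  continuity_pt f a -> is_RInt g a b X -> X = f b - f a.
Proof.
intros Hab Hd Hc HC Hf HX.
assert (Hx : forall x, a < x < b -> Rabs (X - (f b - f x)) <= C * (x - a)).
{ intros x Hx.
  assert (Hr : is_RInt g x b (f b - f x)).
  { apply (is_RInt_derive (V := R_CompleteNormedModule)); intros y Hy;
      rewrite Rmin_left, Rmax_right in Hy by lra; [apply Hd | apply Hc]; lra. }
  destruct (ex_RInt_Chasles_1 (V := R_CompleteNormedModule) g a x b) as [Y HY];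
    [lra | now exists X | ].
  assert (EX : X = Y + (f b - f x)).
  { rewrite <- (is_RInt_unique _ _ _ _ HX); apply is_RInt_unique.
    now apply (is_RInt_Chasles (V := R_NormedModule)) with x. }
  replace (X - (f b - f x)) with Y by lra.
  assert (H1 : is_RInt (fun _ => C) a x (C * (x - a))).
  { apply is_RInt_value with (scal (x - a) C); [apply Rmult_comm | ].
    apply (is_RInt_const (V := R_NormedModule)). }
  assert (H2 : is_RInt (fun _ => - C) a x (- C * (x - a))).
  { apply is_RInt_value with (scal (x - a) (- C)); [apply Rmult_comm | ].
    apply (is_RInt_const (V := R_NormedModule)). }
  assert (HC' : forall y, a < y < x -> - C <= g y <= C).
  { intros y Hy; specialize (HC y ltac:(lra)); now apply Rabs_le_between. }
  apply Rabs_le; split.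
  - replace (- (C * (x - a))) with (- C * (x - a)) by ring.
    apply (is_RInt_le (fun _ => - C) g a x); auto; [lra | ]; intros y Hy; now apply HC'.
  - apply (is_RInt_le g (fun _ => C) a x); auto; [lra | ]; intros y Hy; now apply HC'. }
assert (HC0 : 0 <= C).
{ apply Rle_trans with (2 := HC ((a + b) / 2) ltac:(lra)), Rabs_pos. }
apply Rminus_diag_uniq, cond_eq; intros eps Heps; rewrite Rminus_0_r.
destruct (Hf (eps / 2)) as [d [Hd0 Hd1]]; [lra | ].
set (e := Rmin (Rmin d (b - a)) (eps / (2 * (C + 1))) / 2).
assert (He : 0 < e /\ e < d /\ e < b - a /\ e < eps / (2 * (C + 1))).
{ assert (0 < eps / (2 * (C + 1))) by (apply Rdiv_lt_0_compat; lra).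
  unfold e; unfold Rmin; repeat destruct Rle_dec; lra. }
destruct He as (He0 & He1 & He2 & He3).
specialize (Hx (a + e) ltac:(lra)).
assert (Hfe : Rabs (f (a + e) - f a) < eps / 2).
{ apply Hd1; split; [split; [exact I | lra] | ].
  simpl; unfold Rdist; replace (a + e - a) with e by ring; rewrite Rabs_pos_eq; lra. }
replace (a + e - a) with e in Hx by ring.
assert (C * e <= (C + 1) * (eps / (2 * (C + 1)))) by nra.
replace ((C + 1) * (eps / (2 * (C + 1)))) with (eps / 2) in H by (field; lra).
replace (X - (f b - f a)) with ((X - (f b - f (a + e))) + (f a - f (a + e))) by ring.
apply Rle_lt_trans with (1 := Rabs_triang _ _).
rewrite (Rabs_minus_sym (f a)); lra.
Qed.

(** * The normalized central binomial coefficients *)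

Fixpoint cbin (n : nat) : R :=
  match n with
  | 0%nat => 1
  | S k => cbin k * ((2 * INR k + 1) / (2 * INR k + 2))
  end.

Lemma cbin_S n : cbin (S n) * (2 * INR n + 2) = cbin n * (2 * INR n + 1).
Proof. simpl; pose proof (pos_INR n); field; lra. Qed.

Lemma cbin_pos n : 0 < cbin n.
Proof.
induction n as [|n IH]; simpl; [lra | ].
pose proof (pos_INR n); apply Rmult_lt_0_compat; auto.
apply Rdiv_lt_0_compat; lra.
Qed.

Lemma cbin_decr n : cbin n - cbin (S n) = cbin n / (2 * INR n + 2).
Proof. simpl; pose proof (pos_INR n); field; lra. Qed.

Lemma cbin_le_1 n : cbin n <= 1.
Proof.
induction n as [|n IH]; [simpl; lra | ].
pose proof (cbin_decr n); pose proof (cbin_pos n); pose proof (pos_INR n).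
assert (0 < cbin n / (2 * INR n + 2)) by (apply Rdiv_lt_0_compat; lra).
lra.
Qed.

Lemma Rabs_cbin n : Rabs (cbin n) = cbin n.
Proof. apply Rabs_pos_eq; pose proof (cbin_pos n); lra. Qed.

Lemma cbin_sqr_le n : cbin n ^ 2 * (2 * INR n + 1) <= 1.
Proof.
induction n as [|n IH]; [simpl; lra | ].
pose proof (pos_INR n).
rewrite S_INR; apply Rle_trans with (2 := IH).
replace (cbin (S n)) with (cbin n * ((2 * INR n + 1) / (2 * INR n + 2))) by reflexivity.
assert (0 <= cbin n ^ 2 * (2 * INR n + 1) / (2 * INR n + 2) ^ 2).
{ apply Rmult_le_pos; [ | apply Rlt_le, Rinv_0_lt_compat, pow_lt; lra].
  apply Rmult_le_pos; [apply pow2_ge_0 | lra]. }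
replace ((cbin n * ((2 * INR n + 1) / (2 * INR n + 2))) ^ 2 * (2 * (INR n + 1) + 1))
  with (cbin n ^ 2 * (2 * INR n + 1)
        - cbin n ^ 2 * (2 * INR n + 1) / (2 * INR n + 2) ^ 2) by (field; lra).
lra.
Qed.

Lemma is_lim_seq_inv_odd : is_lim_seq (fun n => / (2 * INR n + 1)) 0.
Proof.
apply (is_lim_seq_inv (fun n => 2 * INR n + 1) p_infty); [ | discriminate].
apply is_lim_seq_le_p_loc with INR; [ | apply is_lim_seq_INR].
exists 0%nat; intros n _; pose proof (pos_INR n); lra.
Qed.

Lemma is_lim_seq_cbin_sqr : is_lim_seq (fun n => cbin n ^ 2) 0.
Proof.
apply is_lim_seq_le_le with (fun _ => 0) (fun n => / (2 * INR n + 1)).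
- intros n; split; [apply pow2_ge_0 | ].
  pose proof (cbin_sqr_le n); pose proof (pos_INR n).
  apply Rmult_le_reg_r with (2 * INR n + 1); [lra | ].
  rewrite Rinv_l; lra.
- apply is_lim_seq_const.
- apply is_lim_seq_inv_odd.
Qed.

Lemma is_lim_seq_cbin : is_lim_seq cbin 0.
Proof.
apply is_lim_seq_ext with (fun n => sqrt (cbin n ^ 2)).
{ intros n; apply sqrt_pow2; pose proof (cbin_pos n); lra. }
replace (Finite 0) with (Finite (sqrt 0)) by (now rewrite sqrt_0).
apply (is_lim_seq_continuous sqrt).
- apply continuity_pt_filterlim, continuous_sqrt.
- apply is_lim_seq_cbin_sqr.
Qed.

Lemma cbin_div_odd_le n : 0 <= cbin n / (2 * INR n + 1) <= 2 * cbin n - 2 * cbin (S n).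
Proof.
pose proof (cbin_decr n); pose proof (cbin_pos n); pose proof (pos_INR n).
split; [apply Rlt_le, Rdiv_lt_0_compat; lra | ].
replace (2 * cbin n - 2 * cbin (S n)) with (cbin n / (INR n + 1)).
- apply Rmult_le_compat_l; [lra | apply Rinv_le_contravar; lra].
- replace (2 * cbin n - 2 * cbin (S n)) with (2 * (cbin n - cbin (S n))) by ring.
  rewrite H; field; lra.
Qed.

(** The terms are at most [2 (cbin n - cbin (S n))], because [cbin n - cbin (S n)] equals
    [cbin n / (2 n + 2)]. *)
Lemma ex_series_cbin_div_odd : ex_series (fun n => cbin n / (2 * INR n + 1)).
Proof.
apply ex_series_telescope with (fun n => 2 * cbin n).
- intros n; pose proof (cbin_pos n); lra.
- apply cbin_div_odd_le.
Qed.

(** Since [cbin n ^ 2 <= / (2 n + 1)], the cubes are dominated by the previous series. *)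
Lemma ex_series_cbin_cube : ex_series (fun n => cbin n ^ 3).
Proof.
apply (ex_series_dominated _ (fun n => cbin n / (2 * INR n + 1)));
  [ | apply ex_series_cbin_div_odd].
intros n; pose proof (cbin_pos n); pose proof (cbin_sqr_le n); pose proof (pos_INR n).
rewrite Rabs_pos_eq by (apply pow_le; lra).
apply Rmult_le_reg_r with (2 * INR n + 1); [lra | ].
unfold Rdiv; rewrite Rmult_assoc, Rinv_l by lra.
replace (cbin n ^ 3 * (2 * INR n + 1)) with (cbin n * (cbin n ^ 2 * (2 * INR n + 1))) by ring.
apply Rmult_le_compat_l; lra.
Qed.

(** Coefficients of [sqrt (1 - t)]: those of [/ sqrt (1 - t)] multiplied by [1 - t]. *)
Definition sqrt_coef (n : nat) : R :=
  match n with 0%nat => 1 | S k => cbin (S k) - cbin k end.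

Lemma sqrt_coef_eq n : sqrt_coef n * (1 - 2 * INR n) = cbin n.
Proof.
destruct n as [|n]; [simpl; ring | ].
unfold sqrt_coef; rewrite S_INR; pose proof (cbin_decr n).
pose proof (cbin_S n); pose proof (pos_INR n).
replace (cbin (S n) - cbin n) with (- (cbin n / (2 * INR n + 2))) by lra.
apply Rmult_eq_reg_r with (2 * INR n + 2); [ | lra].
rewrite H0; field; lra.
Qed.

Lemma ex_series_Rabs_sqrt_coef : ex_series (fun n => Rabs (sqrt_coef n)).
Proof.
apply (ex_series_incr_1 (fun n => Rabs (sqrt_coef n))).
apply ex_series_telescope with cbin.
- intros n; pose proof (cbin_pos n); lra.
- intros n; split; [apply Rabs_pos | ].
  unfold sqrt_coef; rewrite Rabs_minus_sym, Rabs_pos_eq; [lra | ].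
  pose proof (cbin_div_odd_le n); lra.
Qed.

Lemma sqrt_coef_sum N : sum_n sqrt_coef N = cbin N.
Proof.
induction N as [|N IH]; [rewrite sum_O; reflexivity | ].
rewrite sum_Sn, IH; unfold plus; simpl; ring.
Qed.

Lemma cbin_in_disk t : Rabs t < 1 -> Rbar_lt (Rabs t) (CV_radius cbin).
Proof.
apply CV_radius_bounded_ge with 1; intros n; rewrite Rabs_cbin; apply cbin_le_1.
Qed.

(** Both sides satisfy [2 (1 - t) y' = y] and agree at 0. *)
Lemma PSeries_cbin t : Rabs t < 1 -> PSeries cbin t = / sqrt (1 - t).
Proof.
intros Ht.
assert (Hode : forall x, Rabs x < 1 ->
          2 * (1 - x) * PSeries (PS_derive cbin) x = PSeries cbin x).
{ intros x Hx.
  pose proof (cbin_in_disk x Hx) as HR.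
  assert (HR' : Rbar_lt (Rabs x) (CV_radius (PS_derive cbin)))
    by (rewrite CV_radius_derive; auto).
  assert (E1 := PSeries_incr_1 (PS_derive cbin) x).
  assert (ex_pseries (PS_derive cbin) x) by (apply CV_radius_inside; auto).
  assert (ex_pseries (PS_incr_1 (PS_derive cbin)) x) by (apply ex_pseries_incr_1; auto).
  replace (2 * (1 - x) * PSeries (PS_derive cbin) x)
    with (2 * (PSeries (PS_derive cbin) x - PSeries (PS_incr_1 (PS_derive cbin)) x))
    by (rewrite E1; ring).
  rewrite <- PSeries_minus by auto.
  change 2 with (2 : R_AbsRing); rewrite <- (PSeries_scal (2 : R)).
  apply PSeries_ext; intros n.
  unfold PS_scal, PS_minus, PS_plus, PS_opp, PS_incr_1, PS_derive, scal, plus, opp, zero; simpl.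
  destruct n as [|n]; unfold mult, zero; simpl; [field | ].
  pose proof (pos_INR n).
  change (match n with 0%nat => 1 | S _ => INR n + 1 end) with (INR (S n)).
  rewrite S_INR; field; lra. }
assert (H1 : forall x, Rabs x < 1 -> 0 < 1 - x)
  by (intros x Hx; apply Rabs_def2 in Hx; lra).
assert (E : PSeries cbin t * sqrt (1 - t) = PSeries cbin 0 * sqrt (1 - 0)).
{ apply (constant_of_derive_0 (fun x => PSeries cbin x * sqrt (1 - x)) 0 t); intros x Hx.
  assert (Hx1 : Rabs x < 1).
  { apply Rabs_def2 in Ht; apply Rabs_def1.
    - apply Rle_lt_trans with (1 := proj2 Hx); apply Rmax_lub_lt; lra.
    - apply Rlt_le_trans with (2 := proj1 Hx); apply Rmin_glb_lt; lra. }
  pose proof (H1 x Hx1) as Hp; pose proof (sqrt_lt_R0 _ Hp) as Hs.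
  evar_last.
  - apply (is_derive_mult (PSeries cbin) (fun x => sqrt (1 - x))).
    + apply is_derive_PSeries, cbin_in_disk; auto.
    + auto_derive; [lra | reflexivity].
    + intros; apply Rmult_comm.
  - unfold plus, mult; simpl.
    replace (1 + - x) with (1 - x) by ring.
    rewrite <- (Hode x Hx1).
    pose proof (sqrt_sqrt (1 - x) ltac:(lra)) as E.
    set (s := sqrt (1 - x)) in *.
    replace (2 * (1 - x)) with (2 * (s * s)) by (rewrite E; ring).
    field; lra. }
rewrite PSeries_0, Rminus_0_r, sqrt_1 in E.
simpl in E; pose proof (sqrt_lt_R0 _ (H1 t Ht)).
apply Rmult_eq_reg_r with (sqrt (1 - t)); [ | lra].
rewrite E; field; lra.
Qed.

(** The expansion holds up to [t = 1], where the partial sums are the [cbin N], which tend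
    to 0.  This end point gives the value [E(1) = 1] from which the moments start. *)
Lemma is_series_sqrt_coef t : 0 <= t <= 1 ->
  is_series (fun n => sqrt_coef n * t ^ n) (sqrt (1 - t)).
Proof.
intros Ht.
destruct (Req_dec t 1) as [-> | Ht1].
- rewrite Rminus_diag, sqrt_0.
  apply is_series_ext with sqrt_coef; [intros n; rewrite pow1; apply eq_sym, Rmult_1_r | ].
  change (is_lim_seq (sum_n sqrt_coef) 0).
  apply is_lim_seq_ext with cbin; [intros n; symmetry; apply sqrt_coef_sum | ].
  apply is_lim_seq_cbin.
- assert (Hd : Rabs t < 1) by (rewrite Rabs_pos_eq; lra).
  assert (HR := CV_radius_inside _ _ (cbin_in_disk t Hd)).
  assert (H : PSeries sqrt_coef t = sqrt (1 - t)).
  { rewrite (PSeries_ext _ (PS_minus cbin (PS_incr_1 cbin))).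
    - rewrite PSeries_minus; auto; [ | apply ex_pseries_incr_1; auto].
      rewrite PSeries_incr_1, PSeries_cbin by auto.
      assert (Hp : 0 < 1 - t) by lra.
      pose proof (sqrt_sqrt (1 - t) ltac:(lra)); pose proof (sqrt_lt_R0 _ Hp).
      set (s := sqrt (1 - t)) in *; replace t with (1 - s * s) by lra; field; lra.
    - intros n; unfold PS_minus, PS_plus, PS_opp, PS_incr_1, plus, opp, zero; simpl.
      destruct n as [|n]; simpl; ring. }
  rewrite <- H; apply Series_correct.
  apply (ex_series_dominated _ (fun n => Rabs (sqrt_coef n)));
    [ | apply ex_series_Rabs_sqrt_coef].
  intros n; rewrite Rabs_mult; rewrite <- (Rmult_1_r (Rabs (sqrt_coef n))) at 2.
  apply Rmult_le_compat_l; [apply Rabs_pos | ].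
  rewrite <- RPow_abs, <- (pow1 n); apply pow_incr; split; [apply Rabs_pos | lra].
Qed.

(** * Wallis integrals and the elliptic integrals as power series *)

Lemma PI2_pos : 0 < PI / 2.
Proof. pose proof PI_RGT_0; lra. Qed.

Lemma sin_bound_open t : 0 < t < PI / 2 -> 0 < sin t < 1.
Proof.
intros Ht; pose proof PI_RGT_0; split; [apply sin_gt_0; lra | ].
rewrite <- sin_PI2; apply sin_increasing_1; lra.
Qed.

(** The derivative of [- cos t * sin t ^ (n + 1)], a function that vanishes at both ends, is
    [(n + 2) sin t ^ (n + 2) - (n + 1) sin t ^ n]. *)
Lemma is_RInt_sin_pow_SS n l :
  is_RInt (fun t => sin t ^ n) 0 (PI / 2) l ->
  is_RInt (fun t => sin t ^ S (S n)) 0 (PI / 2) ((INR n + 1) / (INR n + 2) * l).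
Proof.
intros H; pose proof (pos_INR n).
assert (H1 : is_RInt (fun t => (INR n + 2) * sin t ^ S (S n) - (INR n + 1) * sin t ^ n)
               0 (PI / 2) 0).
{ apply is_RInt_value with (minus (- cos (PI / 2) * sin (PI / 2) ^ S n) (- cos 0 * sin 0 ^ S n)).
  { rewrite cos_PI2, sin_0; unfold minus, plus, opp; simpl; ring. }
  apply (is_RInt_derive (V := R_CompleteNormedModule) (fun t => - cos t * sin t ^ S n)).
  - intros x _; auto_derive; auto.
    change (match n with 0%nat => 1 | S _ => INR n + 1 end) with (INR (S n)).
    rewrite S_INR; simpl pow.
    pose proof (sin2_cos2 x) as E; unfold Rsqr in E.
    transitivity (sin x * sin x * sin x ^ n - cos x * cos x * (INR n + 1) * sin x ^ n); [ring | ].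
    replace (cos x * cos x) with (1 - sin x * sin x) by lra; ring.
  - intros x _; apply (ex_derive_continuous (V := R_NormedModule)).
    auto_derive; auto. }
apply (is_RInt_ext_all (fun t => / (INR n + 2) *
   (((INR n + 2) * sin t ^ S (S n) - (INR n + 1) * sin t ^ n) + (INR n + 1) * sin t ^ n))).
{ intros x; field; lra. }
apply is_RInt_value with (/ (INR n + 2) * (0 + (INR n + 1) * l)); [field; lra | ].
apply (is_RInt_scal (V := R_NormedModule)), (is_RInt_plus (V := R_NormedModule)); auto.
now apply (is_RInt_scal (V := R_NormedModule)).
Qed.

Lemma is_RInt_sin_pow_even n :
  is_RInt (fun t => sin t ^ (2 * n)) 0 (PI / 2) (PI / 2 * cbin n).
Proof.
induction n as [|n IH].
- apply is_RInt_value with (scal (PI / 2 - 0) 1); [unfold scal; simpl; unfold mult; simpl; ring | ].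
  apply (is_RInt_const (V := R_NormedModule)).
- replace (2 * S n)%nat with (S (S (2 * n))) by lia.
  apply is_RInt_value with (2 := is_RInt_sin_pow_SS _ _ IH).
  pose proof (pos_INR n); rewrite mult_INR; simpl; field; lra.
Qed.

Lemma is_RInt_sin_pow_odd n :
  is_RInt (fun t => sin t ^ (2 * n + 1)) 0 (PI / 2) (/ ((2 * INR n + 1) * cbin n)).
Proof.
induction n as [|n IH].
- apply is_RInt_value with (minus (- cos (PI / 2)) (- cos 0)).
  { rewrite cos_PI2, cos_0; unfold minus, plus, opp; simpl; field. }
  apply (is_RInt_derive (V := R_CompleteNormedModule) (fun t => - cos t)).
  + intros x _; auto_derive; auto; simpl; ring.
  + intros x _; apply (ex_derive_continuous (V := R_NormedModule)); auto_derive; auto.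
- replace (2 * S n + 1)%nat with (S (S (2 * n + 1))) by lia.
  apply is_RInt_value with (2 := is_RInt_sin_pow_SS _ _ IH).
  pose proof (pos_INR n); pose proof (cbin_pos n).
  rewrite plus_INR, mult_INR, (S_INR n); simpl; field; lra.
Qed.

(** Integrating a power series in [sin t ^ 2] over the quarter period multiplies its
    coefficients by [PI / 2 * cbin n]. *)
Lemma is_RInt_series_sin (alpha : nat -> R) :
  ex_series (fun n => Rabs (alpha n)) ->
  is_RInt (fun t => Series (fun n => alpha n * sin t ^ (2 * n))) 0 (PI / 2)
    (PI / 2 * Series (fun n => alpha n * cbin n)).
Proof.
intros Ha.
destruct (is_RInt_Series (fun n t => alpha n * sin t ^ (2 * n)) (fun n => Rabs (alpha n))
            (fun n => alpha n * (PI / 2 * cbin n)) 0 (PI / 2)) as [_ H]; auto.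
- apply PI2_pos.
- intros n; apply (is_RInt_scal (V := R_NormedModule)), is_RInt_sin_pow_even.
- intros n x Hx; pose proof (sin_bound_open x Hx).
  rewrite Rabs_mult; rewrite <- (Rmult_1_r (Rabs (alpha n))) at 2.
  apply Rmult_le_compat_l; [apply Rabs_pos | ].
  rewrite <- RPow_abs, <- (pow1 (2 * n)); apply pow_incr.
  split; [apply Rabs_pos | rewrite Rabs_pos_eq; lra].
- apply is_RInt_value with (2 := H).
  rewrite <- Series_scal_l; apply Series_ext; intros n; ring.
Qed.

Lemma Re_csqrt_sqr x : Re (csqrt x ^ 2)%C = x.
Proof. now rewrite csqrt_sqr. Qed.

Lemma ellipticK_series m : Rabs m < 1 ->
  ellipticK (csqrt m) = PI / 2 * PSeries (fun n => cbin n ^ 2) m.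
Proof.
intros Hm; unfold ellipticK; rewrite Re_csqrt_sqr.
apply is_RInt_unique.
assert (H := is_RInt_series_sin (fun n => cbin n * m ^ n)
               (CV_disk_inside _ _ (cbin_in_disk m Hm))).
apply is_RInt_value with (PI / 2 * Series (fun n => cbin n * m ^ n * cbin n)).
{ f_equal; apply Series_ext; intros n; ring. }
revert H; apply is_RInt_ext_open; [apply PI2_pos | ].
intros t Ht; pose proof (sin_bound_open t Ht).
rewrite <- PSeries_cbin.
- apply Series_ext; intros n; rewrite Rpow_mult_distr, pow_mult; ring.
- rewrite Rabs_mult, (Rabs_pos_eq (sin t ^ 2)) by apply pow2_ge_0.
  apply Rle_lt_trans with (2 := Hm).
  rewrite <- (Rmult_1_r (Rabs m)) at 2; apply Rmult_le_compat_l; [apply Rabs_pos | ].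
  rewrite <- (pow1 2); apply pow_incr; lra.
Qed.

Lemma is_series_ellipticE m : 0 <= m <= 1 ->
  is_series (fun n => PI / 2 * (sqrt_coef n * cbin n) * m ^ n) (ellipticE (csqrt m)).
Proof.
intros Hm; unfold ellipticE; rewrite Re_csqrt_sqr.
assert (Hmp : forall n, 0 <= m ^ n <= 1).
{ intros n; split; [apply pow_le; lra | rewrite <- (pow1 n); apply pow_incr; lra]. }
assert (Ha : ex_series (fun n => Rabs (sqrt_coef n * m ^ n))).
{ apply (ex_series_Rabs_le _ (fun n => Rabs (sqrt_coef n)));
    [ | apply ex_series_Rabs_sqrt_coef].
  intros n; rewrite Rabs_mult, (Rabs_pos_eq (m ^ n)) by apply Hmp.
  rewrite <- (Rmult_1_r (Rabs (sqrt_coef n))) at 2.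
  apply Rmult_le_compat_l; [apply Rabs_pos | apply Hmp]. }
assert (H := is_RInt_series_sin _ Ha).
rewrite (is_RInt_unique _ _ _ (Series (fun n => PI / 2 * (sqrt_coef n * cbin n) * m ^ n))).
- apply Series_correct.
  apply (ex_series_dominated _ (fun n => PI / 2 * Rabs (sqrt_coef n * m ^ n))).
  + intros n.
    replace (PI / 2 * (sqrt_coef n * cbin n) * m ^ n)
      with (PI / 2 * (sqrt_coef n * m ^ n) * cbin n) by ring.
    rewrite Rabs_mult, Rabs_cbin, Rabs_mult, (Rabs_pos_eq (PI / 2))
      by (pose proof PI2_pos; lra).
    pose proof (Rabs_pos (sqrt_coef n * m ^ n)); pose proof PI2_pos.
    pose proof (cbin_le_1 n); pose proof (cbin_pos n).
    set (w := Rabs _) in *; assert (0 <= PI / 2 * w) by nra; nra.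
  + now apply (ex_series_scal (K := R_AbsRing) (V := R_NormedModule)).
- apply is_RInt_value with (PI / 2 * Series (fun n => sqrt_coef n * m ^ n * cbin n)).
  { rewrite <- Series_scal_l; apply Series_ext; intros n; ring. }
  revert H; apply is_RInt_ext_open; [apply PI2_pos | ].
  intros t Ht; pose proof (sin_bound_open t Ht).
  rewrite <- (is_series_unique _ _ (is_series_sqrt_coef (m * sin t ^ 2) ltac:(nra))).
  apply Series_ext; intros n; rewrite Rpow_mult_distr, pow_mult; ring.
Qed.

Lemma ellipticE_1 : ellipticE (csqrt 1) = 1.
Proof.
unfold ellipticE; rewrite Re_csqrt_sqr.
apply is_RInt_unique.
apply is_RInt_value with (minus (sin (PI / 2)) (sin 0)).
{ rewrite sin_PI2, sin_0; unfold minus, plus, opp; simpl; ring. }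
apply (is_RInt_ext_open cos); [apply PI2_pos | | ].
- intros t Ht; pose proof PI_RGT_0; assert (0 < cos t) by (apply cos_gt_0; lra).
  pose proof (sin2_cos2 t) as E; unfold Rsqr in E.
  replace (1 - 1 * sin t ^ 2) with (cos t ^ 2) by (simpl; lra).
  symmetry; apply sqrt_pow2; lra.
- apply (is_RInt_derive (V := R_CompleteNormedModule)).
  + intros x _; auto_derive; auto; ring.
  + intros x _; apply continuous_cos.
Qed.

(** * Moments of the complementary integral of the second kind *)

(** The inverse of the binomial coefficient of [n + k] over [k]. *)
Fixpoint inv_binom (n k : nat) : R :=
  match k with
  | 0%nat => 1
  | S k => inv_binom n k * ((INR k + 1) / (INR n + INR k + 1))
  end.

Lemma inv_binom_bounds n k : 0 <= inv_binom n k <= 1.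
Proof.
induction k as [|k IH]; simpl; [lra | ].
pose proof (pos_INR k); pose proof (pos_INR n).
assert (0 <= (INR k + 1) / (INR n + INR k + 1) <= 1).
{ split; [apply Rlt_le, Rdiv_lt_0_compat; lra | ].
  apply Rmult_le_reg_r with (INR n + INR k + 1); [lra | ].
  unfold Rdiv; rewrite Rmult_assoc, Rinv_l; lra. }
nra.
Qed.

Lemma inv_binom_S n k :
  inv_binom (S n) k = inv_binom n k * ((INR n + 1) / (INR n + INR k + 1)).
Proof.
pose proof (pos_INR n).
induction k as [|k IH].
- simpl; field; lra.
- pose proof (pos_INR k).
  change (inv_binom (S n) (S k))
    with (inv_binom (S n) k * ((INR k + 1) / (INR (S n) + INR k + 1))).
  rewrite IH, !S_INR; simpl inv_binom; field; lra.
Qed.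

Lemma is_RInt_beta n k :
  is_RInt (fun x => x ^ n * (1 - x) ^ k) 0 1 (inv_binom n k / (INR n + INR k + 1)).
Proof.
revert n; induction k as [|k IH]; intros n; pose proof (pos_INR n).
- apply is_RInt_value with (minus (1 ^ S n / (INR n + 1)) (0 ^ S n / (INR n + 1))).
  { rewrite pow1, pow_i by lia; unfold minus, plus, opp; simpl; field; lra. }
  apply (is_RInt_derive (V := R_CompleteNormedModule) (fun x => x ^ S n / (INR n + 1))).
  + intros x _; auto_derive; auto.
    change (match n with 0%nat => 1 | S _ => INR n + 1 end) with (INR (S n)).
    rewrite S_INR; simpl; field; lra.
  + intros x _; apply (ex_derive_continuous (V := R_NormedModule)); auto_derive; auto.
- pose proof (pos_INR k).
  assert (H1 : is_RInt (fun x => (INR n + 1) * (x ^ n * (1 - x) ^ S k)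
                                 - (INR k + 1) * (x ^ S n * (1 - x) ^ k)) 0 1 0).
  { apply is_RInt_value with (minus (1 ^ S n * (1 - 1) ^ S k) (0 ^ S n * (1 - 0) ^ S k)).
    { rewrite Rminus_diag, !pow_i by lia; unfold minus, plus, opp; simpl; ring. }
    apply (is_RInt_derive (V := R_CompleteNormedModule) (fun x => x ^ S n * (1 - x) ^ S k)).
    - intros x _; auto_derive; auto.
      change (match n with 0%nat => 1 | S _ => INR n + 1 end) with (INR (S n)).
      change (match k with 0%nat => 1 | S _ => INR k + 1 end) with (INR (S k)).
      rewrite !S_INR; replace (1 + - x) with (1 - x) by ring; simpl; ring.
    - intros x _; apply (ex_derive_continuous (V := R_NormedModule)); auto_derive; auto. }
  apply (is_RInt_ext_all (fun x => / (INR n + 1) *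
    (((INR n + 1) * (x ^ n * (1 - x) ^ S k) - (INR k + 1) * (x ^ S n * (1 - x) ^ k))
     + (INR k + 1) * (x ^ S n * (1 - x) ^ k)))).
  { intros x; field; lra. }
  apply is_RInt_value with (/ (INR n + 1) *
    (0 + (INR k + 1) * (inv_binom (S n) k / (INR (S n) + INR k + 1)))).
  { rewrite inv_binom_S, !S_INR; simpl inv_binom; field; lra. }
  apply (is_RInt_scal (V := R_NormedModule)), (is_RInt_plus (V := R_NormedModule)); auto.
  apply (is_RInt_scal (V := R_NormedModule)), IH.
Qed.

Definition ellE_coef (k : nat) : R := sqrt_coef k * cbin k.

Lemma ellE_coef_eq k : ellE_coef k * (1 - 2 * INR k) = cbin k ^ 2.
Proof. unfold ellE_coef; rewrite <- (sqrt_coef_eq k) at 2; rewrite <- sqrt_coef_eq; ring. Qed.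

Lemma ellE_coef_S k : ellE_coef (S k) * (2 * INR k + 2) ^ 2 = (4 * INR k ^ 2 - 1) * ellE_coef k.
Proof.
pose proof (pos_INR k).
assert (E1 := ellE_coef_eq (S k)); assert (E0 := ellE_coef_eq k).
assert (E := cbin_S k); rewrite S_INR in E1.
apply Rmult_eq_reg_r with (1 - 2 * (INR k + 1)); [ | lra].
transitivity (cbin (S k) ^ 2 * (2 * INR k + 2) ^ 2); [rewrite <- E1; ring | ].
replace (cbin (S k) ^ 2 * (2 * INR k + 2) ^ 2)
  with ((cbin (S k) * (2 * INR k + 2)) ^ 2) by ring.
rewrite E, Rpow_mult_distr, <- E0; ring.
Qed.

Lemma Rabs_ellE_coef_le k : Rabs (ellE_coef k) <= Rabs (sqrt_coef k).
Proof.
unfold ellE_coef; rewrite Rabs_mult, Rabs_cbin.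
pose proof (Rabs_pos (sqrt_coef k)); pose proof (cbin_le_1 k); pose proof (cbin_pos k); nra.
Qed.

Lemma ex_series_Rabs_ellE_coef : ex_series (fun k => Rabs (ellE_coef k)).
Proof.
apply ex_series_Rabs_le with (fun k => Rabs (sqrt_coef k));
  [apply Rabs_ellE_coef_le | apply ex_series_Rabs_sqrt_coef].
Qed.

Lemma is_lim_seq_INR_ellE_coef : is_lim_seq (fun k => INR k * ellE_coef k) 0.
Proof.
apply is_lim_seq_le_le with (fun k => - cbin k ^ 2) (fun k => cbin k ^ 2).
- intros k; assert (E := ellE_coef_eq k); assert (H := pow2_ge_0 (cbin k)).
  destruct k as [|k]; [simpl INR; lra | ].
  rewrite S_INR in *; pose proof (pos_INR k).
  split; nra.
- replace (Finite 0) with (Rbar_opp (Finite 0)) by (simpl; f_equal; ring).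
  apply (proj1 (is_lim_seq_opp (fun k => cbin k ^ 2) 0)), is_lim_seq_cbin_sqr.
- apply is_lim_seq_cbin_sqr.
Qed.

Lemma ex_series_ellE_inv_binom n : ex_series (fun k => ellE_coef k * inv_binom n k).
Proof.
apply (ex_series_dominated _ (fun k => Rabs (ellE_coef k)));
  [ | apply ex_series_Rabs_ellE_coef].
intros k; rewrite Rabs_mult; pose proof (inv_binom_bounds n k).
rewrite (Rabs_pos_eq (inv_binom n k)) by lra; pose proof (Rabs_pos (ellE_coef k)); nra.
Qed.

(** Termwise integration of the expansion of E in powers of [1 - x]; each term is a beta
    integral. *)
Lemma ellipticE_moment_series n :
  ex_series (fun k => ellE_coef k * (inv_binom n k / (INR n + INR k + 1))) /\
  is_RInt (fun x => x ^ n * ellipticE (csqrt (1 - x))) 0 1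
    (PI / 2 * Series (fun k => ellE_coef k * (inv_binom n k / (INR n + INR k + 1)))).
Proof.
destruct (is_RInt_Series (fun k x => ellE_coef k * (x ^ n * (1 - x) ^ k))
            (fun k => Rabs (ellE_coef k))
            (fun k => ellE_coef k * (inv_binom n k / (INR n + INR k + 1))) 0 1) as [H1 H2].
- lra.
- intros k; apply (is_RInt_scal (V := R_NormedModule)), is_RInt_beta.
- intros k x Hx; rewrite Rabs_mult.
  rewrite <- (Rmult_1_r (Rabs (ellE_coef k))) at 2.
  apply Rmult_le_compat_l; [apply Rabs_pos | ].
  pose proof (pow_unit_interval x n ltac:(lra)).
  pose proof (pow_unit_interval (1 - x) k ltac:(lra)).
  rewrite Rabs_pos_eq; nra.
- apply ex_series_Rabs_ellE_coef.
- split; auto.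
  apply (is_RInt_ext_open (fun x => PI / 2 *
           Series (fun k => ellE_coef k * (x ^ n * (1 - x) ^ k)))); [lra | | ].
  + assert (Hx' : forall x, 0 < x < 1 -> 0 <= 1 - x <= 1) by (intros; lra).
    intros x Hx; rewrite <- (is_series_unique _ _ (is_series_ellipticE (1 - x) (Hx' x Hx))).
    rewrite <- !Series_scal_l; apply Series_ext; intros k; unfold ellE_coef; ring.
  + now apply (is_RInt_scal (V := R_NormedModule)).
Qed.

(** The summands telescope: with [e_k = ellE_coef k], [b_k = inv_binom n k] and [v k = 4 k e_k b_k],
    [((2n+1)(2n+3)/(n+k+1) - 4(n+1)) e_k b_k = v (k+1) - v k].  This is the recursion
    that the differential equation of E gives for its moments. *)
Lemma ellE_moment_recursion n :
  (2 * INR n + 1) * (2 * INR n + 3) *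
    Series (fun k => ellE_coef k * (inv_binom n k / (INR n + INR k + 1))) =
  4 * (INR n + 1) * Series (fun k => ellE_coef k * inv_binom n k).
Proof.
set (v := fun k => 4 * (INR k * ellE_coef k * inv_binom n k)).
assert (Hv : is_lim_seq v 0).
{ replace (Finite 0) with (Rbar_mult 4 (Finite 0)) by (simpl; f_equal; ring).
  apply is_lim_seq_scal_l.
  apply is_lim_seq_abs_0.
  apply is_lim_seq_le_le with (fun _ => 0) (fun k => Rabs (INR k * ellE_coef k)).
  - intros k; split; [apply Rabs_pos | ].
    rewrite Rabs_mult; pose proof (inv_binom_bounds n k).
    rewrite (Rabs_pos_eq (inv_binom n k)) by lra.
    pose proof (Rabs_pos (INR k * ellE_coef k)); nra.
  - apply is_lim_seq_const.
  - apply -> is_lim_seq_abs_0; apply is_lim_seq_INR_ellE_coef. }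
destruct (ellipticE_moment_series n) as [Hex _].
assert (Hex' := ex_series_ellE_inv_binom n).
pose proof (pos_INR n).
apply Rminus_diag_uniq.
rewrite <- !Series_scal_l, <- Series_minus;
  [ | now apply (ex_series_scal (K := R_AbsRing) (V := R_NormedModule))
    | now apply (ex_series_scal (K := R_AbsRing) (V := R_NormedModule))].
replace 0 with (0 - v 0%nat) by (unfold v; simpl; ring).
apply is_series_unique, is_series_telescope; auto.
intros k; unfold v; pose proof (pos_INR k).
assert (E := ellE_coef_S k).
assert (E' : ellE_coef (S k) = (4 * INR k ^ 2 - 1) * ellE_coef k / (2 * INR k + 2) ^ 2).
{ rewrite <- E; field; lra. }
rewrite S_INR; simpl inv_binom; rewrite E'; field; lra.
Qed.

(** For [n = 0] the left side is [E(1) = 1].  Since [inv_binom (S n) k] is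
    [(n + 1) * (inv_binom n k / (n + k + 1))], the step from [n] to [n + 1] is
    [ellE_moment_recursion]. *)
Lemma ellE_inv_binom_sum n :
  PI / 2 * Series (fun k => ellE_coef k * inv_binom n k) = / ((2 * INR n + 1) * cbin n ^ 2).
Proof.
induction n as [|n IH].
- assert (H := is_series_ellipticE 1 ltac:(lra)).
  rewrite ellipticE_1 in H; apply is_series_unique in H.
  transitivity 1; [ | simpl; field].
  rewrite <- H, <- Series_scal_l; apply Series_ext; intros k.
  assert (Hk : inv_binom 0 k = 1).
  { induction k as [|k IH]; simpl; auto; rewrite IH; pose proof (pos_INR k); field; lra. }
  rewrite Hk, pow1; unfold ellE_coef; ring.
- pose proof (pos_INR n); pose proof (cbin_pos n).
  assert (E := ellE_moment_recursion n).
  rewrite (Series_ext (fun k => ellE_coef k * inv_binom (S n) k)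
    (fun k => (INR n + 1) * (ellE_coef k * (inv_binom n k / (INR n + INR k + 1))))).
  2:{ intros k; pose proof (pos_INR k); rewrite inv_binom_S; field; lra. }
  rewrite Series_scal_l.
  set (T := Series (fun k => ellE_coef k * (inv_binom n k / (INR n + INR k + 1)))) in *.
  set (N := Series (fun k => ellE_coef k * inv_binom n k)) in *.
  assert (E2 : PI / 2 * ((INR n + 1) * T) * ((2 * INR n + 1) * (2 * INR n + 3))
               = 4 * (INR n + 1) ^ 2 * / ((2 * INR n + 1) * cbin n ^ 2)).
  { rewrite <- IH; replace (PI / 2 * ((INR n + 1) * T) * ((2 * INR n + 1) * (2 * INR n + 3)))
      with (PI / 2 * (INR n + 1) * ((2 * INR n + 1) * (2 * INR n + 3) * T)) by ring.
    rewrite E; ring. }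
  apply Rmult_eq_reg_r with ((2 * INR n + 1) * (2 * INR n + 3)); [ | nra].
  rewrite E2, S_INR; simpl cbin; field; lra.
Qed.

Lemma is_RInt_ellipticE_moment n :
  is_RInt (fun x => x ^ n * ellipticE (csqrt (1 - x))) 0 1
    (4 * (INR n + 1) / ((2 * INR n + 1) ^ 2 * (2 * INR n + 3) * cbin n ^ 2)).
Proof.
apply is_RInt_value with (2 := proj2 (ellipticE_moment_series n)).
assert (E := ellE_moment_recursion n); assert (E2 := ellE_inv_binom_sum n).
pose proof (pos_INR n); pose proof (cbin_pos n).
set (T := Series (fun k => ellE_coef k * (inv_binom n k / (INR n + INR k + 1)))) in *.
set (N := Series (fun k => ellE_coef k * inv_binom n k)) in *.
apply Rmult_eq_reg_r with ((2 * INR n + 1) * (2 * INR n + 3)); [ | nra].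
replace (PI / 2 * T * ((2 * INR n + 1) * (2 * INR n + 3)))
  with (PI / 2 * ((2 * INR n + 1) * (2 * INR n + 3) * T)) by ring.
rewrite E; replace (PI / 2 * (4 * (INR n + 1) * N)) with (4 * (INR n + 1) * (PI / 2 * N)) by ring.
rewrite E2; field; lra.
Qed.

(** * The square of K as a power series *)

(** The hypothesis on [A] is this differential equation read coefficient by coefficient: with
    [T = x d/dx] it says that [T^2 y = x (T^2 + p T + q) y]. *)
Lemma hypergeometric_equation (A : nat -> R) (p q C x : R) :
  (forall n, (INR n + 1) ^ 2 * A (S n) = (INR n ^ 2 + p * INR n + q) * A n) ->
  (forall n, Rabs (A n) <= C) -> Rabs x < 1 ->
  x * (1 - x) * PSeries (PS_derive (PS_derive A)) x + (1 - (1 + p) * x) * PSeries (PS_derive A) x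
  = q * PSeries A x.
Proof.
intros HA HC Hx.
assert (H0 : ex_pseries A x)
  by (apply CV_radius_inside, (CV_radius_bounded_ge A C); auto).
assert (H1 : ex_pseries (PS_derive A) x)
  by (apply CV_radius_inside; rewrite CV_radius_derive; apply (CV_radius_bounded_ge A C); auto).
assert (H2 : ex_pseries (PS_derive (PS_derive A)) x)
  by (apply CV_radius_inside; rewrite !CV_radius_derive; apply (CV_radius_bounded_ge A C); auto).
set (A1 := PS_derive A) in *; set (A2 := PS_derive A1) in *.
assert (H1i : ex_pseries (PS_incr_1 A1) x) by (apply ex_pseries_incr_1; auto).
assert (H2i : ex_pseries (PS_incr_1 A2) x) by (apply ex_pseries_incr_1; auto).
assert (H2ii : ex_pseries (PS_incr_1 (PS_incr_1 A2)) x) by (apply ex_pseries_incr_1; auto).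
assert (Hs : forall (c : R) (a : nat -> R), ex_pseries a x -> ex_pseries (PS_scal c a) x).
{ intros c a Ha; apply ex_pseries_scal; auto; apply Rmult_comm. }
assert (Hs1 := Hs (1 + p) _ H1i); assert (Hs0 := Hs q _ H0).
assert (E : PSeries (PS_plus (PS_incr_1 A2) A1) x =
            PSeries (PS_plus (PS_incr_1 (PS_incr_1 A2))
                       (PS_plus (PS_scal (1 + p : R) (PS_incr_1 A1)) (PS_scal (q : R) A))) x).
{ apply PSeries_ext; intros n; unfold PS_plus, PS_scal, PS_incr_1, A2, A1, PS_derive, plus, scal, zero.
  simpl; unfold mult; simpl.
  specialize (HA n).
  destruct n as [|[|n]]; rewrite ?S_INR in *; simpl INR in *; [lra | lra | ].
  change (match n with 0%nat => 1 | S _ => INR n + 1 end) with (INR (S n)) in *.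
  rewrite ?S_INR in *; lra. }
rewrite !PSeries_plus in E; auto; [ | now apply ex_pseries_plus].
rewrite !PSeries_scal, !PSeries_incr_1 in E.
lra.
Qed.

(** The equation [(x (1 - x) y')' = y / 4] is singular at 0, but on [[-1, 1/2]] the integral
    operator that inverts it with zero initial value contracts the sup norm by [1/2]. *)
Lemma legendre_equation_unique (D D1 : R -> R) (b : R) :
  -1 <= b <= 1 / 2 ->
  (forall x, Rmin 0 b <= x <= Rmax 0 b -> is_derive D x (D1 x)) ->
  (forall x, Rmin 0 b <= x <= Rmax 0 b -> is_derive (fun x => x * (1 - x) * D1 x) x (D x / 4)) ->
  D 0 = 0 -> D1 0 = 0 -> D b = 0.
Proof.
intros Hb HD HD1 D0 D10.
assert (Hint : Rmin 0 b <= 0 <= Rmax 0 b /\ Rmin 0 b <= b <= Rmax 0 b).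
{ repeat split; auto using Rmin_l, Rmin_r, Rmax_l, Rmax_r. }
destruct Hint as [Hi0 Hib].
assert (Hcont : forall x, Rmin 0 b <= x <= Rmax 0 b -> continuity_pt D x).
{ intros x Hx; apply is_derive_continuity_pt with (D1 x); auto. }
destruct (continuity_ab_maj (fun x => Rabs (D x)) (Rmin 0 b) (Rmax 0 b)) as [m [Hmax Hm]].
{ lra. }
{ intros x Hx; apply (continuity_pt_comp D Rabs); auto; apply Rcontinuity_abs. }
set (M := Rabs (D m)) in *.
assert (HM : 0 <= M) by apply Rabs_pos.
(* the interval from 0 to x lies in the interval from 0 to b *)
assert (Hsub : forall x y, Rmin 0 b <= x <= Rmax 0 b -> Rmin 0 x <= y <= Rmax 0 x ->
                 Rmin 0 b <= y <= Rmax 0 b).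
{ intros x y Hx Hy; split.
  - apply Rle_trans with (2 := proj1 Hy); apply Rmin_glb; lra.
  - apply Rle_trans with (1 := proj2 Hy); apply Rmax_lub; lra. }
assert (Hhalf : forall x, Rmin 0 b <= x <= Rmax 0 b -> -1 <= x <= 1 / 2).
{ intros x Hx; split.
  - apply Rle_trans with (2 := proj1 Hx); apply Rmin_glb; lra.
  - apply Rle_trans with (1 := proj2 Hx); apply Rmax_lub; lra. }
assert (HD1M : forall x, Rmin 0 b <= x <= Rmax 0 b -> Rabs (D1 x) <= M / 2).
{ intros x Hx; destruct (Req_dec x 0) as [-> | Hx0].
  { rewrite D10, Rabs_R0; lra. }
  destruct (MVT_gen (fun x => x * (1 - x) * D1 x) 0 x (fun x => D x / 4)) as [c [Hc E]].
  - intros y Hy; apply HD1, (Hsub x); auto; lra.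
  - intros y Hy; exact (is_derive_continuity_pt _ _ _ (HD1 y (Hsub x y Hx Hy))).
  - assert (HDc := Hmax c (Hsub x c Hx Hc)); cbv beta in HDc.
    assert (Hx2 := Hhalf x Hx).
    assert (E' : (1 - x) * D1 x = D c / 4).
    { apply Rmult_eq_reg_l with x; auto.
      rewrite Rmult_0_l, Rmult_0_l, !Rminus_0_r in E; lra. }
    assert (E2 : (1 - x) * Rabs (D1 x) = Rabs (D c) / 4).
    { rewrite <- (Rabs_pos_eq (1 - x)) at 1 by lra; rewrite <- Rabs_mult, E'.
      unfold Rdiv; rewrite Rabs_mult, (Rabs_pos_eq (/ 4)); lra. }
    pose proof (Rabs_pos (D1 x)); nra. }
assert (HMM : M <= M / 2).
{ destruct (MVT_gen D 0 m D1) as [c [Hc E]].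
  - intros y Hy; apply HD, (Hsub m); auto; lra.
  - intros y Hy; apply Hcont, (Hsub m); auto.
  - assert (H1 := HD1M c (Hsub m c Hm Hc)).
    rewrite D0, !Rminus_0_r in E; unfold M at 1; rewrite E, Rabs_mult.
    assert (Rabs m <= 1) by (apply Rabs_le; specialize (Hhalf m Hm); lra).
    pose proof (Rabs_pos m); pose proof (Rabs_pos (D1 c)); nra. }
specialize (Hmax b Hib); cbv beta in Hmax.
apply Rabs_eq_0; pose proof (Rabs_pos (D b)); lra.
Qed.

(** Coefficients of the hypergeometric series 2F1(1/4, 1/4; 1; z). *)
Fixpoint quarter_coef (n : nat) : R :=
  match n with
  | 0%nat => 1
  | S k => quarter_coef k * ((4 * INR k + 1) / (4 * INR k + 4)) ^ 2
  end.

Lemma quarter_coef_bounds n : 0 <= quarter_coef n <= 1.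
Proof.
induction n as [|n IH]; simpl; [lra | ].
pose proof (pos_INR n).
assert (0 <= (4 * INR n + 1) / (4 * INR n + 4) <= 1).
{ split; [apply Rlt_le, Rdiv_lt_0_compat; lra | ].
  apply Rmult_le_reg_r with (4 * INR n + 4); [lra | ].
  unfold Rdiv; rewrite Rmult_assoc, Rinv_l; lra. }
assert (H2 := pow_unit_interval _ 2 H0); simpl in H2; nra.
Qed.

Lemma Rabs_quarter_coef_le n : Rabs (quarter_coef n) <= 1.
Proof. pose proof (quarter_coef_bounds n); rewrite Rabs_pos_eq; lra. Qed.

Lemma Rabs_cbin_pow_le n k : Rabs (cbin n ^ k) <= 1.
Proof.
pose proof (pow_unit_interval (cbin n) k).
pose proof (cbin_pos n); pose proof (cbin_le_1 n).
rewrite Rabs_pos_eq; lra.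
Qed.

(** Certificate of creative telescoping for the Cauchy square of [quarter_coef]:
    with [N = n + 1] and [G k = k^2 (2 k - 3 N) c_k c_(N-k)], the combination
    [N^3 c_k c_(N-k) - (N - 1/2)^3 c_k c_(N-1-k)] equals [G (k + 1) - G k]. *)
Lemma quarter_coef_certificate k j :
  let N := INR k + INR j + 1 in
  N ^ 3 * (quarter_coef k * quarter_coef (S j))
  - (N - 1 / 2) ^ 3 * (quarter_coef k * quarter_coef j) =
  (INR k + 1) ^ 2 * (2 * (INR k + 1) - 3 * N) * (quarter_coef (S k) * quarter_coef j)
  - INR k ^ 2 * (2 * INR k - 3 * N) * (quarter_coef k * quarter_coef (S j)).
Proof.
simpl quarter_coef; pose proof (pos_INR k); pose proof (pos_INR j); simpl; field; lra.
Qed.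

(** Creative telescoping shows that [d_n = PS_mult quarter_coef quarter_coef n] satisfies
    [(n + 1)^3 d_(n+1) = (n + 1/2)^3 d_n], the recursion of [cbin n ^ 3].  The sum of the
    certificate runs up to [k = n]; its boundary value supplies the term [k = n + 1]. *)
Lemma quarter_coef_square n : PS_mult quarter_coef quarter_coef n = cbin n ^ 3.
Proof.
induction n as [|n IH]; [unfold PS_mult; simpl; ring | ].
pose proof (pos_INR n).
set (N := INR n + 1).
set (G := fun k => INR k ^ 2 * (2 * INR k - 3 * N) * (quarter_coef k * quarter_coef (S n - k))).
assert (Htel : forall m, (m <= n)%nat ->
  N ^ 3 * sum_f_R0 (fun k => quarter_coef k * quarter_coef (S n - k)) m
  - (N - 1 / 2) ^ 3 * sum_f_R0 (fun k => quarter_coef k * quarter_coef (n - k)) m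
  = G (S m) - G 0%nat).
{ assert (Hstep : forall k, (k <= n)%nat ->
    N ^ 3 * (quarter_coef k * quarter_coef (S n - k))
    - (N - 1 / 2) ^ 3 * (quarter_coef k * quarter_coef (n - k)) = G (S k) - G k).
  { intros k Hk; unfold G.
    replace (S n - k)%nat with (S (n - k)) by lia.
    replace (S n - S k)%nat with (n - k)%nat by lia.
    assert (EN : N = INR k + INR (n - k) + 1) by (unfold N; rewrite minus_INR by auto; ring).
    rewrite EN, S_INR; apply quarter_coef_certificate. }
  intros m; induction m as [|m IHm]; intros Hm.
  - apply Hstep; lia.
  - rewrite !tech5.
    specialize (IHm ltac:(lia)); specialize (Hstep (S m) Hm); lra. }
specialize (Htel n (le_n n)).
unfold PS_mult in *; rewrite IH in Htel; rewrite tech5.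
unfold G in Htel; replace (S n - S n)%nat with 0%nat in * by lia.
rewrite S_INR in Htel; simpl (INR 0) in Htel; fold N in Htel.
simpl (quarter_coef 0) in *.
set (Sg := sum_f_R0 (fun k => quarter_coef k * quarter_coef (S n - k)) n) in *; set (c := quarter_coef (S n)) in *.
assert (E : N ^ 3 * (Sg + c * 1) = (N - 1 / 2) ^ 3 * cbin n ^ 3) by lra.
apply Rmult_eq_reg_l with (N ^ 3); [ | apply pow_nonzero; unfold N; lra].
rewrite E; simpl cbin; unfold N; field; lra.
Qed.

(** As functions of [m] both sides solve [(m (1 - m) y')' = y / 4] with value 1 and slope 1/4
    at 0.  For [m > -1/5] the point [4 m (1 - m)] stays in the disk of convergence. *)
Lemma quadratic_transformation m : -1 / 5 < m < 1 / 2 ->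
  PSeries (fun n => cbin n ^ 2) m = PSeries quarter_coef (4 * m * (1 - m)).
Proof.
intros Hm.
set (A := fun n => cbin n ^ 2).
assert (HA : forall n, Rabs (A n) <= 1) by (intros; apply Rabs_cbin_pow_le).
assert (HFode : forall x, Rabs x < 1 -> x * (1 - x) * PSeries (PS_derive (PS_derive A)) x +
   (1 - 2 * x) * PSeries (PS_derive A) x = / 4 * PSeries A x).
{ intros x Hx; replace (1 - 2 * x) with (1 - (1 + 1) * x) by ring.
  apply hypergeometric_equation with 1; auto.
  intros n; unfold A; simpl cbin; pose proof (pos_INR n); field; lra. }
assert (Hfode : forall x, Rabs x < 1 ->
   x * (1 - x) * PSeries (PS_derive (PS_derive quarter_coef)) x +
   (1 - (1 + / 2) * x) * PSeries (PS_derive quarter_coef) x = / 16 * PSeries quarter_coef x).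
{ intros x Hx; apply hypergeometric_equation with 1; auto using Rabs_quarter_coef_le.
  intros n; simpl quarter_coef; pose proof (pos_INR n); field; lra. }
assert (Hder : forall a : nat -> R, (forall n, Rabs (a n) <= 1) -> forall x, Rabs x < 1 ->
   is_derive (PSeries a) x (PSeries (PS_derive a) x) /\
   is_derive (PSeries (PS_derive a)) x (PSeries (PS_derive (PS_derive a)) x)).
{ intros a Ha x Hx; split; apply is_derive_PSeries; rewrite ?CV_radius_derive;
    now apply CV_radius_bounded_ge with 1. }
assert (HdF := Hder A HA); assert (Hdf := Hder _ Rabs_quarter_coef_le); clear Hder.
assert (HF10 : PSeries (PS_derive A) 0 = / 4)
  by (rewrite PSeries_0; unfold PS_derive, A; simpl; field).
assert (Hf10 : PSeries (PS_derive quarter_coef) 0 = / 16)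
  by (rewrite PSeries_0; unfold PS_derive; simpl; field).
assert (HF0 : PSeries A 0 = 1) by (rewrite PSeries_0; unfold A; simpl; ring).
assert (Hf0 : PSeries quarter_coef 0 = 1) by (rewrite PSeries_0; reflexivity).
set (F := PSeries A) in *; set (F1 := PSeries (PS_derive A)) in *.
set (F2 := PSeries (PS_derive (PS_derive A))) in *.
set (f := PSeries quarter_coef) in *; set (f1 := PSeries (PS_derive quarter_coef)) in *.
set (f2 := PSeries (PS_derive (PS_derive quarter_coef))) in *.
clearbody F F1 F2 f f1 f2.
assert (Hz : forall x, Rmin 0 m <= x <= Rmax 0 m -> Rabs x < 1 /\ Rabs (4 * x * (1 - x)) < 1).
{ intros x Hx.
  assert (-1 / 5 < x) by (apply Rlt_le_trans with (2 := proj1 Hx); apply Rmin_glb_lt; lra).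
  assert (x < 1 / 2) by (apply Rle_lt_trans with (1 := proj2 Hx); apply Rmax_lub_lt; lra).
  split; apply Rabs_def1; nra. }
apply Rminus_diag_uniq.
apply (legendre_equation_unique (fun x => F x - f (4 * x * (1 - x)))
         (fun x => F1 x - 4 * (1 - 2 * x) * f1 (4 * x * (1 - x)))); [lra | | | | ].
- intros x Hx; destruct (Hz x Hx) as [Hx1 Hx2].
  destruct (HdF x Hx1) as [dF _]; destruct (Hdf _ Hx2) as [df _].
  auto_derive.
  + repeat split; eexists; eassumption.
  + change (1 + - x) with (1 - x).
    replace (Derive (fun x : R => F x) x) with (F1 x) by (symmetry; apply is_derive_unique, dF).
    replace (Derive (fun x : R => f x) (4 * x * (1 - x))) with (f1 (4 * x * (1 - x)))
      by (symmetry; apply is_derive_unique, df).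
    ring.
- intros x Hx; destruct (Hz x Hx) as [Hx1 Hx2].
  destruct (HdF x Hx1) as [_ dF]; destruct (Hdf _ Hx2) as [_ df].
  auto_derive.
  + repeat split; eexists; eassumption.
  + change (1 + - x) with (1 - x).
    replace (Derive (fun x : R => F1 x) x) with (F2 x) by (symmetry; apply is_derive_unique, dF).
    replace (Derive (fun x : R => f1 x) (4 * x * (1 - x))) with (f2 (4 * x * (1 - x)))
      by (symmetry; apply is_derive_unique, df).
    specialize (HFode x Hx1); specialize (Hfode _ Hx2).
    set (z := 4 * x * (1 - x)) in *.
    transitivity ((x * (1 - x) * F2 x + (1 - 2 * x) * F1 x)
                  - 4 * (z * (1 - z) * f2 z + (1 - (1 + / 2) * z) * f1 z)).
    { unfold z; field. }
    rewrite HFode, Hfode; field.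
- rewrite !Rmult_0_r, Rmult_0_l, HF0, Hf0; ring.
- rewrite !Rmult_0_r, Rmult_0_l, HF10, Hf10; field.
Qed.

(** Clausen's formula: for [m = (1 - sqrt (1 - z)) / 2] one has [4 m (1 - m) = z], so that
    [quadratic_transformation] turns K into a series in [z] whose square is known. *)
Lemma ellipticK_sqr_series z : -1 / 4 <= z < 1 ->
  ellipticK (csqrt ((1 - sqrt (1 - z)) / 2)) ^ 2 =
  PI ^ 2 / 4 * Series (fun n => cbin n ^ 3 * z ^ n).
Proof.
intros Hz.
assert (Hs := sqrt_sqrt (1 - z) ltac:(lra)); assert (Hs0 := sqrt_lt_R0 (1 - z) ltac:(lra)).
set (s := sqrt (1 - z)) in *.
assert (Hs1 : s < 7 / 5) by nra.
assert (Habs : Rabs z < 1) by (apply Rabs_def1; lra).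
assert (HR : Rbar_lt (Rabs z) (CV_radius quarter_coef))
  by (apply CV_radius_bounded_ge with 1; auto using Rabs_quarter_coef_le).
rewrite ellipticK_series by (apply Rabs_def1; lra).
rewrite quadratic_transformation by lra.
replace (4 * ((1 - s) / 2) * (1 - (1 - s) / 2)) with (1 - s * s) by field.
rewrite Hs; replace (1 - (1 - z)) with z by ring.
change (Series (fun n => cbin n ^ 3 * z ^ n)) with (PSeries (fun n => cbin n ^ 3) z).
rewrite <- (PSeries_ext _ _ z quarter_coef_square), PSeries_mult by auto.
field.
Qed.

(** * Reduction of the integrals to series *)

(** A quarter of [cbin n ^ 3] times the n-th moment of [E(sqrt (1 - x))]. *)
Definition reduced_coef (n : nat) : R :=
  cbin n * ((INR n + 1) / ((2 * INR n + 1) ^ 2 * (2 * INR n + 3))).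

Lemma ellipticE_bounded :
  exists C, forall m, 0 <= m <= 1 -> Rabs (ellipticE (csqrt m)) <= C.
Proof.
exists (Series (fun k => PI / 2 * Rabs (ellE_coef k))); intros m Hm.
assert (Hle : forall k, 0 <= Rabs (PI / 2 * (sqrt_coef k * cbin k) * m ^ k)
                        <= PI / 2 * Rabs (ellE_coef k)).
{ intros k; split; [apply Rabs_pos | ].
  pose proof PI2_pos; pose proof (pow_unit_interval m k Hm).
  rewrite (Rabs_mult _ (m ^ k)), (Rabs_mult (PI / 2)), (Rabs_pos_eq (PI / 2)),
    (Rabs_pos_eq (m ^ k)) by lra.
  fold (ellE_coef k); pose proof (Rabs_pos (ellE_coef k)).
  assert (0 <= PI / 2 * Rabs (ellE_coef k)) by nra; nra. }
assert (Hex : ex_series (fun k => PI / 2 * Rabs (ellE_coef k))).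
{ apply (ex_series_scal (K := R_AbsRing) (V := R_NormedModule)), ex_series_Rabs_ellE_coef. }
rewrite <- (is_series_unique _ _ (is_series_ellipticE m Hm)).
apply Rle_trans with (1 := Series_Rabs _ (ex_series_Rabs_le _ _ (fun k => proj2 (Hle k)) Hex)).
now apply Series_le.
Qed.

Lemma is_RInt_ellipticE_K_sqr z : -1 / 4 <= z <= 1 ->
  is_RInt (fun x => ellipticE (csqrt (1 - x)) *
                    ellipticK (csqrt ((1 - sqrt (1 - z * x)) / 2)) ^ 2) 0 1
    (PI ^ 2 * Series (fun n => reduced_coef n * z ^ n)).
Proof.
intros Hz; destruct ellipticE_bounded as [C HC].
destruct (is_RInt_Series
  (fun n x => cbin n ^ 3 * z ^ n * (x ^ n * ellipticE (csqrt (1 - x))))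
  (fun n => cbin n ^ 3 * C)
  (fun n => cbin n ^ 3 * z ^ n *
     (4 * (INR n + 1) / ((2 * INR n + 1) ^ 2 * (2 * INR n + 3) * cbin n ^ 2))) 0 1)
  as [_ H].
- lra.
- intros n; apply (is_RInt_scal (V := R_NormedModule)), is_RInt_ellipticE_moment.
- intros n x Hx.
  assert (H0 : 0 <= cbin n ^ 3) by (apply pow_le; pose proof (cbin_pos n); lra).
  rewrite !Rabs_mult, (Rabs_pos_eq (cbin n ^ 3)), Rmult_assoc by auto.
  apply Rmult_le_compat_l; auto.
  rewrite <- !RPow_abs.
  pose proof (pow_unit_interval (Rabs z) n (conj (Rabs_pos z) (Rabs_le z 1 ltac:(lra)))).
  assert (Hx' : 0 <= Rabs x <= 1) by (rewrite Rabs_pos_eq; lra).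
  pose proof (pow_unit_interval (Rabs x) n Hx').
  specialize (HC (1 - x) ltac:(lra)); pose proof (Rabs_pos (ellipticE (csqrt (1 - x)))).
  set (e := Rabs (ellipticE _)) in *.
  assert (Rabs x ^ n * e <= C) by nra.
  assert (0 <= Rabs x ^ n * e) by nra; nra.
- apply (ex_series_scal_r C), ex_series_cbin_cube.
- apply is_RInt_value with (PI ^ 2 / 4 * Series (fun n => cbin n ^ 3 * z ^ n *
     (4 * (INR n + 1) / ((2 * INR n + 1) ^ 2 * (2 * INR n + 3) * cbin n ^ 2)))).
  { replace (PI ^ 2) with (PI ^ 2 / 4 * 4) at 2 by field.
    rewrite Rmult_assoc; f_equal; rewrite <- Series_scal_l; apply Series_ext; intros n.
    unfold reduced_coef; pose proof (pos_INR n); pose proof (cbin_pos n); field; lra. }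
  apply (is_RInt_ext_open (fun x => PI ^ 2 / 4 * Series (fun n =>
           cbin n ^ 3 * z ^ n * (x ^ n * ellipticE (csqrt (1 - x)))))); [lra | | ].
  + intros x Hx; rewrite ellipticK_sqr_series by nra.
    rewrite (Series_ext _ (fun n => cbin n ^ 3 * (z * x) ^ n * ellipticE (csqrt (1 - x)))).
    * rewrite Series_scal_r; ring.
    * intros n; rewrite Rpow_mult_distr; ring.
  + now apply (is_RInt_scal (V := R_NormedModule)).
Qed.

(** * The inverse sine and the inverse hyperbolic sine *)

(** A common setting for [(sin, cos)] with [z = 1] and [(sinh, cosh)] with [z = -1].  The bound
    [s t < 1] keeps [z * s t ^ 2] inside the disk of convergence of the arcsine series. *)
Record sine_pair (z : R) (s c : R -> R) (u : R) : Prop := {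
  sp_sign : z = 1 \/ z = -1;
  sp_pos : 0 < u;
  sp_ds : forall t, is_derive s t (c t);
  sp_dc : forall t, is_derive c t (- z * s t);
  sp_pyth : forall t, c t ^ 2 = 1 - z * s t ^ 2;
  sp_s0 : s 0 = 0;
  sp_c : forall t, 0 <= t < u -> 0 < c t;
  sp_s : forall t, 0 < t < u -> 0 < s t < 1 }.

Definition arcsin_coef (n : nat) : R := cbin n / (2 * INR n + 1).

Lemma arcsin_coef_bounds n : 0 <= arcsin_coef n <= 1.
Proof.
pose proof (cbin_pos n); pose proof (cbin_le_1 n); pose proof (pos_INR n).
unfold arcsin_coef; split; [apply Rlt_le, Rdiv_lt_0_compat; lra | ].
apply Rmult_le_reg_r with (2 * INR n + 1); [lra | ].
unfold Rdiv; rewrite Rmult_assoc, Rinv_l; lra.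
Qed.

Lemma Rabs_arcsin_coef_le n : Rabs (arcsin_coef n) <= 1.
Proof. pose proof (arcsin_coef_bounds n); rewrite Rabs_pos_eq; lra. Qed.

(** The operator [y + 2 w y'] multiplies the n-th coefficient by [2 n + 1]. *)
Lemma PSeries_arcsin_coef_derive w : Rabs w < 1 ->
  PSeries arcsin_coef w + 2 * w * PSeries (PS_derive arcsin_coef) w = / sqrt (1 - w).
Proof.
intros Hw.
assert (H0 : ex_pseries arcsin_coef w)
  by (apply CV_radius_inside, CV_radius_bounded_ge with 1; auto using Rabs_arcsin_coef_le).
assert (H1 : ex_pseries (PS_derive arcsin_coef) w).
{ apply CV_radius_inside; rewrite CV_radius_derive.
  apply CV_radius_bounded_ge with 1; auto using Rabs_arcsin_coef_le. }
rewrite <- PSeries_cbin, Rmult_assoc, <- PSeries_incr_1 by auto.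
rewrite <- (PSeries_scal (2 : R)), <- PSeries_plus; auto.
- apply PSeries_ext; intros n.
  unfold PS_plus, PS_scal, PS_incr_1, PS_derive, plus, scal, zero; simpl; unfold mult; simpl.
  destruct n as [|n]; unfold arcsin_coef; [simpl; field | ].
  change (match n with 0%nat => 1 | S _ => INR n + 1 end) with (INR (S n)).
  rewrite S_INR; pose proof (pos_INR n); field; lra.
- apply ex_pseries_scal; [apply Rmult_comm | now apply ex_pseries_incr_1].
Qed.

(** By the previous lemma [s * P(z s^2)], with P the arcsine series, has derivative
    [c / sqrt (1 - z s^2) = 1]. *)
Lemma sine_pair_inverse z s c u : sine_pair z s c u -> forall t, 0 < t < u ->
  t = Series (fun n => arcsin_coef n * z ^ n * s t ^ (2 * n + 1)).
Proof.
intros H t Ht.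
assert (Hw : forall x, 0 <= x < u -> Rabs (z * s x ^ 2) < 1).
{ intros x Hx; assert (0 <= s x < 1).
  { destruct (Req_dec x 0) as [-> | Hx0]; [rewrite (sp_s0 _ _ _ _ H); lra | ].
    pose proof (sp_s _ _ _ _ H x); lra. }
  assert (0 <= s x ^ 2 < 1) by nra.
  destruct (sp_sign _ _ _ _ H) as [-> | ->]; apply Rabs_def1; lra. }
assert (E : s t * PSeries arcsin_coef (z * s t ^ 2) - t =
            s 0 * PSeries arcsin_coef (z * s 0 ^ 2) - 0).
{ apply (constant_of_derive_0 (fun x => s x * PSeries arcsin_coef (z * s x ^ 2) - x) 0 t).
  intros x Hx; rewrite Rmin_left, Rmax_right in Hx by lra.
  specialize (Hw x ltac:(lra)).
  assert (Hc := sp_c _ _ _ _ H x ltac:(lra)).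
  assert (ds := sp_ds _ _ _ _ H x).
  assert (dP : is_derive (PSeries arcsin_coef) (z * s x ^ 2)
                 (PSeries (PS_derive arcsin_coef) (z * s x ^ 2))).
  { apply is_derive_PSeries, CV_radius_bounded_ge with 1; auto using Rabs_arcsin_coef_le. }
  assert (E := PSeries_arcsin_coef_derive _ Hw).
  rewrite <- (sp_pyth _ _ _ _ H x), sqrt_pow2 in E by lra.
  set (P := PSeries arcsin_coef) in *; set (P1 := PSeries (PS_derive _)) in *.
  clearbody P P1; auto_derive.
  - repeat split; eexists; eassumption.
  - replace (z * (s x * (s x * 1))) with (z * s x ^ 2) by ring.
    replace (Derive (fun x : R => s x) x) with (c x) by (symmetry; apply is_derive_unique, ds).
    replace (Derive (fun x : R => P x) (z * s x ^ 2)) with (P1 (z * s x ^ 2))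
      by (symmetry; apply is_derive_unique, dP).
    transitivity (c x * (P (z * s x ^ 2) + 2 * (z * s x ^ 2) * P1 (z * s x ^ 2)) - 1);
      [simpl; ring | rewrite E; field; lra]. }
rewrite (sp_s0 _ _ _ _ H), Rmult_0_l in E.
transitivity (s t * PSeries arcsin_coef (z * s t ^ 2)); [lra | ].
unfold PSeries; rewrite <- Series_scal_l; apply Series_ext; intros n.
rewrite Rpow_mult_distr, <- pow_mult, pow_add, pow_1; ring.
Qed.

Lemma is_RInt_sine_pair_pow z s c u k : sine_pair z s c u ->
  is_RInt (fun t => c t * s t ^ k) 0 u (s u ^ S k / (INR k + 1)).
Proof.
intros H; pose proof (pos_INR k).
apply is_RInt_value with (minus (s u ^ S k / (INR k + 1)) (s 0 ^ S k / (INR k + 1))).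
{ rewrite (sp_s0 _ _ _ _ H), pow_i by lia; unfold minus, plus, opp; simpl; field; lra. }
apply (is_RInt_derive (V := R_CompleteNormedModule) (fun t => s t ^ S k / (INR k + 1))).
- intros x _; assert (ds := sp_ds _ _ _ _ H x).
  auto_derive; [eexists; eassumption | ].
  replace (Derive (fun x : R => s x) x) with (c x) by (symmetry; apply is_derive_unique, ds).
  change (match k with 0%nat => 1 | S _ => INR k + 1 end) with (INR (S k)).
  rewrite S_INR; simpl; field; lra.
- intros x _; apply (ex_derive_continuous (V := R_NormedModule)).
  assert (ds := sp_ds _ _ _ _ H x); assert (dc := sp_dc _ _ _ _ H x).
  auto_derive; repeat split; eexists; eassumption.
Qed.

(** Termwise integration of the expansion of [t] against [c t * s t ^ k / s t]; the common
    power [s t] is divided out first so that [k = 0] is allowed. *)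
Lemma is_RInt_sine_pair_series z s c u k : sine_pair z s c u ->
  ex_series (fun n => arcsin_coef n * z ^ n * (s u ^ S (2 * n + k) / (INR (2 * n + k) + 1))) /\
  is_RInt (fun t => t / s t * (c t * s t ^ k)) 0 u
    (Series (fun n => arcsin_coef n * z ^ n * (s u ^ S (2 * n + k) / (INR (2 * n + k) + 1)))).
Proof.
intros H; pose proof (sp_pos _ _ _ _ H).
destruct (is_RInt_Series
   (fun n t => arcsin_coef n * z ^ n * (c t * s t ^ (2 * n + k)))
   (fun n => arcsin_coef n * 2)
   (fun n => arcsin_coef n * z ^ n * (s u ^ S (2 * n + k) / (INR (2 * n + k) + 1))) 0 u)
  as [H1 H2].
- auto.
- intros n; apply (is_RInt_scal (V := R_NormedModule)), is_RInt_sine_pair_pow with z; auto.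
- intros n t Ht; pose proof (arcsin_coef_bounds n).
  rewrite !Rabs_mult, (Rabs_pos_eq (arcsin_coef n)), Rmult_assoc by lra.
  apply Rmult_le_compat_l; [lra | ].
  assert (Hz : Rabs (z ^ n) = 1).
  { destruct (sp_sign _ _ _ _ H) as [-> | ->]; [rewrite pow1; apply Rabs_R1 | apply pow_1_abs]. }
  rewrite Hz, Rmult_1_l.
  pose proof (sp_c _ _ _ _ H t ltac:(lra)); pose proof (sp_s _ _ _ _ H t Ht).
  pose proof (pow_unit_interval (s t) (2 * n + k) ltac:(lra)).
  rewrite (Rabs_pos_eq (c t)), (Rabs_pos_eq (s t ^ _)) by lra.
  (* the constant 2 in the bound: [c t ^ 2 = 1 - z * s t ^ 2 <= 2] *)
  assert (c t <= 2).
  { pose proof (sp_pyth _ _ _ _ H t).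
    destruct (sp_sign _ _ _ _ H) as [-> | ->]; nra. }
  nra.
- apply (ex_series_scal_r 2), ex_series_cbin_div_odd.
- split; auto.
  revert H2; apply is_RInt_ext_open; auto.
  intros t Ht; pose proof (sp_s _ _ _ _ H t Ht).
  transitivity (Series (fun n => arcsin_coef n * z ^ n * s t ^ (2 * n + 1)) / s t
                * (c t * s t ^ k)); [ | now rewrite <- (sine_pair_inverse _ _ _ _ H t Ht)].
  unfold Rdiv; rewrite <- Series_scal_r, <- Series_scal_r.
  apply Series_ext; intros n; rewrite !pow_add, pow_1; field; lra.
Qed.

(** Partial fractions: [4 (n+1) / ((2n+1)^2 (2n+3)) = 1 / (2n+1)^2 + 1 / ((2n+1)(2n+3))].
    The two parts are integrals of [t] against [c / s] and against [c s]; the second one is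
    elementary. *)
Lemma reduced_series z s c u X : sine_pair z s c u -> 0 < s u ->
  is_RInt (fun t => t * c t / s t) 0 u X ->
  Series (fun n => reduced_coef n * (z * s u ^ 2) ^ n) =
  X / (4 * s u) + (u * s u ^ 2 / 2 - z * (u - s u * c u) / 4) / (4 * s u ^ 3).
Proof.
intros H Hs HX; pose proof (sp_pos _ _ _ _ H).
destruct (is_RInt_sine_pair_series z s c u 0 H) as [Hex0 HI0].
destruct (is_RInt_sine_pair_series z s c u 2 H) as [Hex2 HI2].
assert (E0 : Series (fun n => arcsin_coef n * z ^ n *
               (s u ^ S (2 * n + 0) / (INR (2 * n + 0) + 1))) = X).
{ rewrite <- (is_RInt_unique _ _ _ _ HI0); apply is_RInt_unique.
  revert HX; apply is_RInt_ext_open; auto.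
  intros t Ht; pose proof (sp_s _ _ _ _ H t Ht); simpl; field; lra. }
assert (E2 : Series (fun n => arcsin_coef n * z ^ n *
               (s u ^ S (2 * n + 2) / (INR (2 * n + 2) + 1)))
             = u * s u ^ 2 / 2 - z * (u - s u * c u) / 4).
{ rewrite <- (is_RInt_unique _ _ _ _ HI2); apply is_RInt_unique.
  set (Y := fun t => t * s t ^ 2 / 2 - z * (t - s t * c t) / 4).
  apply (is_RInt_ext_open (fun t => t * c t * s t)); auto.
  { intros t Ht; pose proof (sp_s _ _ _ _ H t Ht); simpl; field; lra. }
  apply is_RInt_value with (minus (Y u) (Y 0)).
  { unfold Y; rewrite (sp_s0 _ _ _ _ H); unfold minus, plus, opp; simpl; field. }
  apply (is_RInt_derive (V := R_CompleteNormedModule)).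
  - intros x _; assert (ds := sp_ds _ _ _ _ H x); assert (dc := sp_dc _ _ _ _ H x).
    unfold Y; auto_derive; [repeat split; eexists; eassumption | ].
    replace (Derive (fun x : R => s x) x) with (c x) by (symmetry; apply is_derive_unique, ds).
    replace (Derive (fun x : R => c x) x) with (- z * s x)
      by (symmetry; apply is_derive_unique, dc).
    assert (E := sp_pyth _ _ _ _ H x); destruct (sp_sign _ _ _ _ H) as [-> | ->]; simpl in *; nra.
  - intros x _; apply (ex_derive_continuous (V := R_NormedModule)).
    assert (ds := sp_ds _ _ _ _ H x); assert (dc := sp_dc _ _ _ _ H x).
    auto_derive; repeat split; eexists; eassumption. }
rewrite <- E2, <- E0.
set (f0 := fun n => arcsin_coef n * z ^ n * (s u ^ S (2 * n + 0) / (INR (2 * n + 0) + 1))) in *.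
set (f2 := fun n => arcsin_coef n * z ^ n * (s u ^ S (2 * n + 2) / (INR (2 * n + 2) + 1))) in *.
unfold Rdiv; rewrite <- !Series_scal_r, <- Series_plus.
- apply Series_ext; intros n; pose proof (pos_INR n).
  unfold reduced_coef, f0, f2, arcsin_coef.
  rewrite !plus_INR, mult_INR, Rpow_mult_distr, <- pow_mult; simpl (INR 2); simpl (INR 0).
  replace (S (2 * n + 0)) with (2 * n + 1)%nat by lia.
  replace (S (2 * n + 2)) with (2 * n + 3)%nat by lia.
  rewrite !pow_add, pow_1; field; lra.
- now apply (ex_series_scal_r).
- now apply (ex_series_scal_r).
Qed.

(** * Integrals of the cotangent against the angle *)

Lemma sine_pair_trig u : 0 < u <= PI / 2 -> sine_pair 1 sin cos u.
Proof.
intros Hu; pose proof PI_RGT_0; split; try lra.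
- intros t; auto_derive; auto; ring.
- intros t; auto_derive; auto; ring.
- intros t; pose proof (sin2_cos2 t) as E; unfold Rsqr in E; simpl; lra.
- apply sin_0.
- intros t Ht; apply cos_gt_0; lra.
- intros t Ht; apply sin_bound_open; lra.
Qed.

Lemma PI4_bounds : 0 < PI / 4 < PI / 2.
Proof. pose proof PI_RGT_0; lra. Qed.

Lemma sin_cos_pos t : 0 < t < PI / 2 -> 0 < sin t /\ 0 < cos t.
Proof.
intros Ht; pose proof PI_RGT_0; split; [apply sin_gt_0 | apply cos_gt_0]; lra.
Qed.

Lemma ex_RInt_cot u : 0 < u <= PI / 2 -> ex_RInt (fun t => t * cos t / sin t) 0 u.
Proof.
intros Hu; destruct (is_RInt_sine_pair_series 1 sin cos u 0 (sine_pair_trig u Hu)) as [_ H].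
eexists; eapply is_RInt_ext_open; [lra | | exact H].
intros t Ht; pose proof (sin_cos_pos t ltac:(lra)); simpl; field; lra.
Qed.

Lemma ex_RInt_tan : ex_RInt (fun t => t * sin t / cos t) 0 (PI / 4).
Proof.
pose proof PI4_bounds.
apply (ex_RInt_continuous (V := R_CompleteNormedModule)); intros t Ht.
rewrite Rmin_left, Rmax_right in Ht by lra.
apply (ex_derive_continuous (V := R_NormedModule)); auto_derive.
apply Rgt_not_eq, cos_gt_0; lra.
Qed.

Lemma ln_cos_PI4 : ln (cos (PI / 4)) = - (ln 2 / 2).
Proof.
rewrite cos_PI4; replace (1 / sqrt 2) with (/ sqrt 2) by (unfold Rdiv; ring).
rewrite ln_Rinv, <- Rpower_sqrt by (try apply sqrt_lt_R0; lra).
unfold Rpower; rewrite ln_exp; lra.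
Qed.

Lemma is_RInt_tan : is_RInt (fun t => sin t / cos t) 0 (PI / 4) (ln 2 / 2).
Proof.
pose proof PI4_bounds.
apply is_RInt_value with (minus (- ln (cos (PI / 4))) (- ln (cos 0))).
{ rewrite ln_cos_PI4, cos_0, ln_1; unfold minus, plus, opp; simpl; ring. }
apply (is_RInt_derive (V := R_CompleteNormedModule) (fun t => - ln (cos t)));
  intros t Ht; rewrite Rmin_left, Rmax_right in Ht by lra;
  assert (0 < cos t) by (apply cos_gt_0; lra).
- auto_derive; auto; field; lra.
- apply (ex_derive_continuous (V := R_NormedModule)); auto_derive; lra.
Qed.

(** Halving the angle, [cot t = (cot (t/2) - tan (t/2)) / 2], expresses the integral over the
    quarter period by integrals over [[0, PI/4]]. *)
Lemma cot_integral_halving (a J : R) :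
  is_RInt (fun t => t * cos t / sin t) 0 (PI / 4) a ->
  is_RInt (fun t => t * sin t / cos t) 0 (PI / 4) J ->
  is_RInt (fun t => t * cos t / sin t) 0 (PI / 2) (2 * (a - J)).
Proof.
intros Ha HJ; pose proof PI4_bounds.
assert (H1 := is_RInt_minus (V := R_NormedModule) _ _ _ _ _ _ Ha HJ).
assert (H2 : is_RInt (fun t => t * cos t / sin t - t * sin t / cos t)
               (/ 2 * 0 + 0) (/ 2 * (PI / 2) + 0) (a - J)).
{ replace (/ 2 * 0 + 0) with 0 by ring; replace (/ 2 * (PI / 2) + 0) with (PI / 4) by field.
  exact H1. }
apply (is_RInt_comp_lin (V := R_NormedModule)) in H2.
apply (is_RInt_scal (V := R_NormedModule) _ _ _ 2) in H2.
revert H2; apply is_RInt_ext_open; [lra | ]; intros t Ht.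
unfold scal; simpl; unfold mult; simpl.
replace (/ 2 * t + 0) with (t / 2) by field.
assert (Et : t = 2 * (t / 2)) by field.
assert (Ec := cos_2a (t / 2)); assert (Es := sin_2a (t / 2)); rewrite <- Et in Ec, Es.
rewrite Ec, Es.
pose proof (sin_cos_pos (t / 2) ltac:(lra)); field; lra.
Qed.

(** The reflection [t -> PI/2 - t] maps [[PI/4, PI/2]] to [[0, PI/4]]. *)
Lemma cot_integral_reflection (a J : R) :
  is_RInt (fun t => t * cos t / sin t) 0 (PI / 4) a ->
  is_RInt (fun t => t * sin t / cos t) 0 (PI / 4) J ->
  is_RInt (fun t => t * cos t / sin t) 0 (PI / 2) (a + (PI / 4 * ln 2 - J)).
Proof.
intros Ha HJ; pose proof PI4_bounds.
apply (is_RInt_Chasles (V := R_NormedModule)) with (PI / 4); auto.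
assert (H1 : is_RInt (fun t => PI / 2 * (sin t / cos t) - t * sin t / cos t) 0 (PI / 4)
               (PI / 4 * ln 2 - J)).
{ apply (is_RInt_minus (V := R_NormedModule)); auto.
  apply is_RInt_value with (PI / 2 * (ln 2 / 2)); [field | ].
  apply (is_RInt_scal (V := R_NormedModule)), is_RInt_tan. }
apply (is_RInt_swap (V := R_NormedModule)) in H1.
assert (H2 : is_RInt (fun t => PI / 2 * (sin t / cos t) - t * sin t / cos t)
   (- 1 * (PI / 4) + PI / 2) (- 1 * (PI / 2) + PI / 2) (- (PI / 4 * ln 2 - J))).
{ replace (- 1 * (PI / 4) + PI / 2) with (PI / 4) by field.
  replace (- 1 * (PI / 2) + PI / 2) with 0 by field; exact H1. }
apply (is_RInt_comp_lin (V := R_NormedModule)) in H2.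
apply (is_RInt_scal (V := R_NormedModule) _ _ _ (- 1)) in H2.
apply is_RInt_value with (- 1 * - (PI / 4 * ln 2 - J)); [ring | ].
revert H2; apply is_RInt_ext_open; [lra | ]; intros t Ht.
unfold scal; simpl; unfold mult; simpl.
replace (- 1 * t + PI / 2) with (PI / 2 - t) by ring.
rewrite sin_shift, cos_shift.
pose proof (sin_cos_pos t ltac:(lra)); field; lra.
Qed.

(** Remainder of the Gregory series of the arctangent, evaluated at [tan t]. *)
Fixpoint gregory_rest (N : nat) (t : R) : R :=
  match N with
  | 0%nat => t
  | S k => gregory_rest k t - (-1) ^ k * (tan t ^ (2 * k + 1) / INR (2 * k + 1))
  end.

Lemma INR_odd k : INR (2 * k + 1) = 2 * INR k + 1.
Proof. rewrite plus_INR, mult_INR; simpl; ring. Qed.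

Lemma is_derive_tan_pow k t : 0 < cos t ->
  is_derive (fun t => tan t ^ (2 * k + 1) / INR (2 * k + 1)) t
    (tan t ^ (2 * k) * (tan t ^ 2 + 1)).
Proof.
intros Hc; rewrite INR_odd; pose proof (pos_INR k).
evar_last.
- apply (is_derive_ext (fun t => / (2 * INR k + 1) * tan t ^ (2 * k + 1))).
  + intros; unfold Rdiv; apply Rmult_comm.
  + apply is_derive_scal, is_derive_pow, is_derive_tan; lra.
- rewrite INR_odd; replace (pred (2 * k + 1)) with (2 * k)%nat by lia.
  field; lra.
Qed.

(** The derivatives of the removed terms form a finite geometric series in [- tan t ^ 2]. *)
Lemma is_derive_gregory_rest N t : 0 < cos t ->
  is_derive (gregory_rest N) t ((-1) ^ N * tan t ^ (2 * N)).
Proof.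
intros Hc; induction N as [|N IH].
- simpl; rewrite Rmult_1_l; apply (is_derive_id t).
- evar_last.
  + apply (is_derive_minus (V := R_NormedModule) (gregory_rest N)
             (fun t => (-1) ^ N * (tan t ^ (2 * N + 1) / INR (2 * N + 1)))); [exact IH | ].
    apply is_derive_scal, is_derive_tan_pow, Hc.
  + unfold minus, plus, opp; simpl opp.
    replace (2 * S N)%nat with (2 * N + 2)%nat by lia.
    rewrite pow_add; simpl; ring.
Qed.

Lemma gregory_rest_0 N : gregory_rest N 0 = 0.
Proof.
induction N as [|N IH]; simpl; auto.
rewrite IH, tan_0, pow_i by lia; unfold Rdiv; ring.
Qed.

Lemma nonneg_derive_le (f df : R -> R) (t : R) :
  0 < t -> (forall x, 0 <= x <= t -> is_derive f x (df x)) ->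
  (forall x, 0 <= x <= t -> 0 <= df x) -> f 0 <= f t.
Proof.
intros Ht Hd Hp.
destruct (MVT_gen f 0 t df) as [c [Hc E]];
  rewrite ?Rmin_left, ?Rmax_right in * by lra.
- intros x Hx; apply Hd; lra.
- intros x Hx; apply is_derive_continuity_pt with (df x); auto.
- specialize (Hp c Hc); nra.
Qed.

(** The derivative [(-1)^N tan t ^ (2 N)] of the remainder is dominated by
    [tan t ^ (2 N) (1 + tan t ^ 2)], the derivative of the bound, and both vanish at 0. *)
Lemma gregory_rest_bound N t : 0 < t < PI / 2 ->
  Rabs (gregory_rest N t) <= tan t ^ (2 * N + 1) / INR (2 * N + 1).
Proof.
intros Ht.
assert (Hc : forall x, 0 <= x <= t -> 0 < cos x) by (intros; apply cos_gt_0; lra).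
assert (Hodd : tan 0 ^ (2 * N + 1) / INR (2 * N + 1) = 0)
  by (rewrite tan_0, pow_i by lia; unfold Rdiv; ring).
assert (Hpos : forall x, 0 <= tan x ^ (2 * N))
  by (intros x; rewrite pow_mult; apply pow_le, pow2_ge_0).
assert (Hsgn : -1 <= (-1) ^ N <= 1).
{ apply Rabs_le_between; rewrite pow_1_abs; lra. }
apply Rabs_le; split.
- assert (H := nonneg_derive_le
    (fun x => tan x ^ (2 * N + 1) / INR (2 * N + 1) + gregory_rest N x)
    (fun x => tan x ^ (2 * N) * (tan x ^ 2 + 1) + (-1) ^ N * tan x ^ (2 * N)) t).
  cbv beta in H; rewrite Hodd, gregory_rest_0 in H; cut (0 + 0 <= tan t ^ (2 * N + 1) / INR (2 * N + 1)
    + gregory_rest N t); [intros; lra | apply H; [lra | | ]].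
  + intros x Hx; apply (is_derive_plus (V := R_NormedModule));
      [apply is_derive_tan_pow | apply is_derive_gregory_rest]; auto.
  + intros x Hx; specialize (Hpos x).
    assert (0 <= tan x ^ (2 * N) * tan x ^ 2)
      by (apply Rmult_le_pos; [exact Hpos | apply pow2_ge_0]).
    nra.
- assert (H := nonneg_derive_le
    (fun x => tan x ^ (2 * N + 1) / INR (2 * N + 1) - gregory_rest N x)
    (fun x => tan x ^ (2 * N) * (tan x ^ 2 + 1) - (-1) ^ N * tan x ^ (2 * N)) t).
  cbv beta in H; rewrite Hodd, gregory_rest_0 in H; cut (0 - 0 <= tan t ^ (2 * N + 1) / INR (2 * N + 1)
    - gregory_rest N t); [intros; lra | apply H; [lra | | ]].
  + intros x Hx; apply (is_derive_minus (V := R_NormedModule));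
      [apply is_derive_tan_pow | apply is_derive_gregory_rest]; auto.
  + intros x Hx; specialize (Hpos x).
    assert (0 <= tan x ^ (2 * N) * tan x ^ 2)
      by (apply Rmult_le_pos; [exact Hpos | apply pow2_ge_0]).
    nra.
Qed.

Lemma is_RInt_tan_pow k :
  is_RInt (fun t => tan t ^ (2 * k) * (tan t ^ 2 + 1)) 0 (PI / 4) (/ INR (2 * k + 1)).
Proof.
pose proof PI4_bounds.
apply is_RInt_value with (minus (tan (PI / 4) ^ (2 * k + 1) / INR (2 * k + 1))
                                (tan 0 ^ (2 * k + 1) / INR (2 * k + 1))).
{ rewrite tan_PI4, tan_0, pow1, pow_i by lia; unfold minus, plus, opp; simpl; unfold Rdiv; ring. }
apply (is_RInt_derive (V := R_CompleteNormedModule)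
        (fun t => tan t ^ (2 * k + 1) / INR (2 * k + 1)));
  intros t Ht; rewrite Rmin_left, Rmax_right in Ht by lra;
  assert (Hc : 0 < cos t) by (apply cos_gt_0; lra).
- now apply is_derive_tan_pow.
- apply (ex_derive_continuous (V := R_NormedModule)); unfold tan; auto_derive; lra.
Qed.

(** Expanding [t] by the Gregory series in [tan t] and integrating against
    [dt / (sin t cos t) = d(tan t) / tan t] gives Catalan's constant. *)
Lemma catalan_integral (X : R) :
  is_RInt (fun t => t / (sin t * cos t)) 0 (PI / 4) X -> X = catalanG.
Proof.
intros HX; pose proof PI4_bounds.
set (term := fun n => (-1) ^ n / INR (2 * n + 1) ^ 2).
assert (Hsc : forall t, 0 < t < PI / 4 -> 0 < sin t /\ 0 < cos t)
  by (intros; apply sin_cos_pos; lra).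
assert (Hsec : forall t, 0 < cos t -> tan t ^ 2 + 1 = / cos t ^ 2).
{ intros t Hc; pose proof (sin2_cos2 t) as E; unfold Rsqr in E.
  unfold tan; transitivity ((sin t * sin t + cos t * cos t) / cos t ^ 2);
    [field; lra | rewrite E; field; lra]. }
assert (Hrest : forall N, is_RInt (fun t => gregory_rest (S N) t / (sin t * cos t)) 0 (PI / 4)
                  (X - sum_n term N)).
{ assert (Hstep : forall N Y, is_RInt (fun t => gregory_rest N t / (sin t * cos t)) 0 (PI / 4) Y ->
     is_RInt (fun t => gregory_rest (S N) t / (sin t * cos t)) 0 (PI / 4) (Y - term N)).
  { intros N Y HY.
    assert (HN : INR (2 * N + 1) <> 0) by (rewrite INR_odd; pose proof (pos_INR N); lra).
    apply (is_RInt_ext_open (fun t => gregory_rest N t / (sin t * cos t) -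
      (-1) ^ N / INR (2 * N + 1) * (tan t ^ (2 * N) * (tan t ^ 2 + 1)))); [lra | | ].
    - intros t Ht; destruct (Hsc t Ht) as [Hs Hc]; rewrite Hsec by auto.
      change (gregory_rest (S N) t)
        with (gregory_rest N t - (-1) ^ N * (tan t ^ (2 * N + 1) / INR (2 * N + 1))).
      rewrite pow_add, pow_1.
      replace (tan t ^ (2 * N) * tan t) with (tan t ^ (2 * N) * (sin t / cos t)) by reflexivity.
      field; repeat split; auto; lra.
    - apply (is_RInt_minus (V := R_NormedModule)); auto.
      apply is_RInt_value with ((-1) ^ N / INR (2 * N + 1) * / INR (2 * N + 1));
        [unfold term; field; auto | ].
      apply (is_RInt_scal (V := R_NormedModule)), is_RInt_tan_pow. }
  intros N; induction N as [|N IH].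
  - rewrite sum_O; apply Hstep, HX.
  - rewrite sum_Sn; unfold plus; simpl.
    replace (X - (sum_n term N + term (S N))) with (X - sum_n term N - term (S N)) by ring.
    now apply Hstep. }
assert (Hbound : forall N, Rabs (X - sum_n term N) <= / (2 * INR (S N) + 1)).
{ intros N; rewrite <- INR_odd.
  set (m := INR (2 * S N + 1)).
  assert (Hm : 1 <= m) by (unfold m; rewrite INR_odd; pose proof (pos_INR (S N)); lra).
  assert (Hpt : forall t, 0 < t < PI / 4 -> Rabs (gregory_rest (S N) t / (sin t * cos t)) <=
                  / m * (tan t ^ (2 * S N) * (tan t ^ 2 + 1))).
  { intros t Ht; destruct (Hsc t Ht) as [Hs Hc]; rewrite Hsec by auto.
    assert (Hp : 0 < / (sin t * cos t)) by (apply Rinv_0_lt_compat; nra).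
    unfold Rdiv; rewrite Rabs_mult, (Rabs_pos_eq (/ _)) by lra.
    apply Rle_trans with (tan t ^ (2 * S N + 1) / m * / (sin t * cos t)).
    - apply Rmult_le_compat_r; [lra | ].
      apply gregory_rest_bound; lra.
    - apply Req_le; rewrite pow_add, pow_1.
      replace (tan t ^ (2 * S N) * tan t) with (tan t ^ (2 * S N) * (sin t / cos t))
        by reflexivity.
      field; lra. }
  assert (HI : is_RInt (fun t => / m * (tan t ^ (2 * S N) * (tan t ^ 2 + 1))) 0 (PI / 4)
                 (/ m * / m)).
  { apply (is_RInt_scal (V := R_NormedModule)), is_RInt_tan_pow. }
  assert (Hm2 : / m * / m <= / m).
  { assert (0 < / m <= 1); [ | nra].
    split; [apply Rinv_0_lt_compat; lra | rewrite <- Rinv_1; apply Rinv_le_contravar; lra]. }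
  apply Rle_trans with (2 := Hm2); apply Rabs_le; split.
  - assert (HI' : is_RInt (fun t => - (/ m * (tan t ^ (2 * S N) * (tan t ^ 2 + 1)))) 0 (PI / 4)
                 (- (/ m * / m))) by now apply (is_RInt_opp (V := R_NormedModule)).
    apply (is_RInt_le _ _ 0 (PI / 4) _ _ ltac:(lra) HI' (Hrest N)); intros t Ht.
    specialize (Hpt t Ht); apply Rabs_le_between in Hpt; lra.
  - apply (is_RInt_le _ _ 0 (PI / 4) _ _ ltac:(lra) (Hrest N) HI); intros t Ht.
    specialize (Hpt t Ht); apply Rabs_le_between in Hpt; lra. }
unfold catalanG; symmetry; apply is_series_unique.
change (is_lim_seq (sum_n term) X).
apply is_lim_seq_ext with (fun N => X - (X - sum_n term N)); [intros; ring | ].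
replace (Finite X) with (Finite (X - 0)) by (f_equal; ring).
apply is_lim_seq_minus'; [apply is_lim_seq_const | ].
apply is_lim_seq_abs_0, is_lim_seq_le_le with (fun _ => 0) (fun N => / (2 * INR (S N) + 1)).
- intros N; split; [apply Rabs_pos | apply Hbound].
- apply is_lim_seq_const.
- apply (proj1 (is_lim_seq_incr_1 (fun N => / (2 * INR N + 1)) 0)), is_lim_seq_inv_odd.
Qed.

(** Halving and reflection are two expressions of the first integral by the integrals [a] and
    [J] of [t cot t] and [t tan t] over [[0, PI/4]]; their equality gives [a - J], and
    [a + J = catalanG] because [cot t + tan t = 1 / (sin t cos t)]. *)
Lemma cot_integrals :
  is_RInt (fun t => t * cos t / sin t) 0 (PI / 2) (PI / 2 * ln 2) /\
  is_RInt (fun t => t * cos t / sin t) 0 (PI / 4) (catalanG / 2 + PI / 8 * ln 2).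
Proof.
pose proof PI4_bounds.
destruct (ex_RInt_cot (PI / 4) ltac:(lra)) as [a Ha].
destruct ex_RInt_tan as [J HJ].
assert (H1 := cot_integral_halving a J Ha HJ).
assert (H2 := cot_integral_reflection a J Ha HJ).
assert (E1 := is_RInt_unique _ _ _ _ H1); rewrite (is_RInt_unique _ _ _ _ H2) in E1.
assert (E2 : a + J = catalanG).
{ apply catalan_integral.
  apply (is_RInt_ext_open (fun t => t * cos t / sin t + t * sin t / cos t)); [lra | | ].
  - intros t Ht; destruct (sin_cos_pos t ltac:(lra)) as [Hs Hc].
    pose proof (sin2_cos2 t) as E; unfold Rsqr in E.
    transitivity (t * (sin t * sin t + cos t * cos t) / (sin t * cos t)); [field; lra | ].
    rewrite E; field; lra.
  - now apply (is_RInt_plus (V := R_NormedModule)). }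
split.
- revert H1; apply is_RInt_value; lra.
- revert Ha; apply is_RInt_value; lra.
Qed.

(** * The dilogarithm at the inverse square of the golden ratio *)

Definition dilog_coef (n : nat) : R :=
  match n with 0%nat => 0 | S k => / (INR k + 1) ^ 2 end.

Definition dilog (x : R) : R := PSeries dilog_coef x.

Lemma dilog_coef_bounds n : 0 <= dilog_coef n <= 1.
Proof.
destruct n as [|n]; simpl dilog_coef; [lra | ].
pose proof (pos_INR n).
assert (1 <= (INR n + 1) ^ 2) by nra.
split; [apply Rlt_le, Rinv_0_lt_compat; lra | ].
rewrite <- Rinv_1; apply Rinv_le_contravar; lra.
Qed.

Lemma Rabs_dilog_coef_le n : Rabs (dilog_coef n) <= 1.
Proof. pose proof (dilog_coef_bounds n); rewrite Rabs_pos_eq; lra. Qed.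

Lemma ex_series_dilog_coef : ex_series dilog_coef.
Proof.
apply (ex_series_incr_1 dilog_coef).
apply ex_series_telescope with (fun n => 2 * / (INR n + 1)).
- intros n; pose proof (pos_INR n).
  assert (0 < / (INR n + 1)) by (apply Rinv_0_lt_compat; lra); lra.
- intros n; split; [apply dilog_coef_bounds | ].
  rewrite S_INR; simpl dilog_coef; pose proof (pos_INR n).
  replace (2 * / (INR n + 1) - 2 * / (INR n + 1 + 1))
    with (/ ((INR n + 1) * (INR n + 2) / 2)) by (field; lra).
  apply Rinv_le_contravar; nra.
Qed.

(** The coefficients of [x * dilog' x] are [1 / n], those of [- ln (1 - x)]. *)
Lemma is_derive_dilog x : 0 < x < 1 -> is_derive dilog x (- ln (1 - x) / x).
Proof.
intros Hx.
set (L := PS_derive dilog_coef).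
assert (HL : forall n, L n = / (INR n + 1)).
{ intros n; unfold L, PS_derive; rewrite S_INR; simpl dilog_coef.
  pose proof (pos_INR n); field; lra. }
assert (Hin : forall y, Rabs y < 1 -> Rbar_lt (Rabs y) (CV_radius dilog_coef))
  by (intros; apply CV_radius_bounded_ge with 1; auto using Rabs_dilog_coef_le).
assert (HLi : forall n, Rabs (PS_incr_1 L n) <= 1).
{ intros [|n]; [change (Rabs 0 <= 1); rewrite Rabs_R0; lra | ].
  change (Rabs (L n) <= 1); rewrite HL; pose proof (pos_INR n).
  rewrite Rabs_pos_eq by (apply Rlt_le, Rinv_0_lt_compat; lra).
  rewrite <- Rinv_1; apply Rinv_le_contravar; lra. }
assert (E : PSeries (PS_incr_1 L) x + ln (1 - x) = PSeries (PS_incr_1 L) 0 + ln (1 - 0)).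
{ apply (constant_of_derive_0 (fun y => PSeries (PS_incr_1 L) y + ln (1 - y)) 0 x).
  intros y Hy; rewrite Rmin_left, Rmax_right in Hy by lra.
  assert (Hy1 : Rabs y < 1) by (rewrite Rabs_pos_eq; lra).
  evar_last.
  - apply (is_derive_plus (V := R_NormedModule) (PSeries (PS_incr_1 L)) (fun y => ln (1 - y))).
    + apply is_derive_PSeries, CV_radius_bounded_ge with 1; auto.
    + auto_derive; [lra | reflexivity].
  - unfold plus; simpl.
    rewrite (PSeries_ext _ (fun _ => 1)).
    + unfold PSeries; rewrite (Series_ext _ (fun n => y ^ n)) by (intros; ring).
      rewrite Series_geom by auto; field; lra.
    + intros n; unfold PS_derive, PS_incr_1; rewrite HL, S_INR.
      pose proof (pos_INR n); field; lra. }
rewrite PSeries_0, Rminus_0_r, ln_1, PSeries_incr_1 in E; simpl in E.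
evar_last.
- apply is_derive_PSeries, Hin; rewrite Rabs_pos_eq; lra.
- fold L; unfold zero in E; simpl in E.
  apply Rmult_eq_reg_l with x; [ | lra].
  transitivity (- ln (1 - x)); [lra | field; lra].
Qed.

(** Euler: integrating the arcsine expansion of [t] over the quarter period gives the sum of
    the inverse odd squares. *)
Lemma dilog_1 : dilog 1 = PI ^ 2 / 6.
Proof.
pose proof PI2_pos.
assert (Hodd : is_series (fun n => / (2 * INR n + 1) ^ 2) (PI ^ 2 / 8)).
{ destruct (is_RInt_Series (fun n t => arcsin_coef n * sin t ^ (2 * n + 1)) arcsin_coef
     (fun n => arcsin_coef n * / ((2 * INR n + 1) * cbin n)) 0 (PI / 2)) as [Hex HI].
  - auto.
  - intros n; apply (is_RInt_scal (V := R_NormedModule)), is_RInt_sin_pow_odd.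
  - intros n t Ht; pose proof (arcsin_coef_bounds n).
    rewrite Rabs_mult, (Rabs_pos_eq (arcsin_coef n)) by lra.
    pose proof (sin_bound_open t Ht).
    pose proof (pow_unit_interval (sin t) (2 * n + 1) ltac:(lra)).
    rewrite Rabs_pos_eq; nra.
  - apply ex_series_cbin_div_odd.
  - assert (E : Series (fun n => arcsin_coef n * / ((2 * INR n + 1) * cbin n)) = PI ^ 2 / 8).
    { rewrite <- (is_RInt_unique _ _ _ _ HI); apply is_RInt_unique.
      apply (is_RInt_ext_open (fun t => t)); auto.
      - intros t Ht; rewrite (sine_pair_inverse _ _ _ _ (sine_pair_trig (PI / 2) ltac:(lra)) t Ht) at 1.
        apply Series_ext; intros n; rewrite pow1; ring.
      - apply is_RInt_value with (minus ((PI / 2) ^ 2 / 2) (0 ^ 2 / 2)).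
        { unfold minus, plus, opp; simpl; field. }
        apply (is_RInt_derive (V := R_CompleteNormedModule) (fun t => t ^ 2 / 2)).
        + intros t _; auto_derive; auto; field.
        + intros t _; apply continuous_id. }
    rewrite <- E; apply is_series_ext_R with (2 := Series_correct _ Hex).
    intros n; unfold arcsin_coef; pose proof (pos_INR n); pose proof (cbin_pos n); field; lra. }
assert (Hall := Series_correct _ ex_series_dilog_coef).
assert (E1 : Series dilog_coef = dilog 1).
{ unfold dilog, PSeries; apply Series_ext; intros n; rewrite pow1; ring. }
rewrite E1 in Hall.
assert (Heven : is_pseries (fun n => dilog_coef (2 * n)) (1 ^ 2) (/ 4 * dilog 1)).
{ apply is_pseries_R, is_series_ext_R with (fun n => / 4 * dilog_coef n).
  - intros n; rewrite !pow1, Rmult_1_r; destruct n as [|n]; [simpl; ring | ].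
    replace (2 * S n)%nat with (S (2 * n + 1)) by lia; unfold dilog_coef.
    rewrite INR_odd; pose proof (pos_INR n); field; lra.
  - now apply (is_series_scal_l (K := R_AbsRing) (V := R_NormedModule) (/ 4)). }
assert (Hodd' : is_pseries (fun n => dilog_coef (2 * n + 1)) (1 ^ 2) (PI ^ 2 / 8)).
{ apply is_pseries_R, is_series_ext_R with (2 := Hodd).
  intros n; rewrite !pow1, Rmult_1_r, Nat.add_1_r; unfold dilog_coef.
  now rewrite mult_INR. }
assert (H1 := is_pseries_unique _ _ _ (is_pseries_odd_even _ _ _ _ Heven Hodd')).
fold (dilog 1) in H1; lra.
Qed.

(** The retraction of the line on [[-1, 1]].  As the series of [dilog] diverges beyond 1,
    continuity at 1 is expressed for [dilog] composed with this retraction. *)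
Definition clamp (x : R) : R := (Rabs (x + 1) - Rabs (x - 1)) / 2.

Lemma clamp_id x : -1 <= x <= 1 -> clamp x = x.
Proof.
intros Hx; unfold clamp.
rewrite Rabs_pos_eq, Rabs_minus_sym, Rabs_pos_eq by lra; field.
Qed.

Lemma clamp_bound x : Rabs (clamp x) <= 1.
Proof.
unfold clamp; apply Rabs_le.
unfold Rabs; repeat destruct Rcase_abs; lra.
Qed.

Lemma continuity_pt_clamp x : continuity_pt clamp x.
Proof.
unfold clamp; apply (continuity_pt_mult (fun x => Rabs (x + 1) - Rabs (x - 1)) (fun _ => / 2));
  [ | apply continuity_pt_const; now intros ? ?].
apply continuity_pt_minus.
- apply (continuity_pt_comp (fun x => x + 1) Rabs); [ | apply Rcontinuity_abs].
  apply is_derive_continuity_pt with 1; auto_derive; auto.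
- apply (continuity_pt_comp (fun x => x - 1) Rabs); [ | apply Rcontinuity_abs].
  apply is_derive_continuity_pt with 1; auto_derive; auto.
Qed.

Lemma continuity_pt_dilog_clamp x : continuity_pt (fun x => dilog (clamp x)) x.
Proof.
apply (continuity_pt_Series (fun n x => dilog_coef n * clamp x ^ n) dilog_coef).
- intros n y; pose proof (dilog_coef_bounds n).
  rewrite Rabs_mult, <- RPow_abs, (Rabs_pos_eq (dilog_coef n)) by lra.
  pose proof (pow_unit_interval (Rabs (clamp y)) n (conj (Rabs_pos _) (clamp_bound y))); nra.
- apply ex_series_dilog_coef.
- intros n y; apply continuity_pt_mult; [apply continuity_pt_const; now intros ? ? | ].
  apply (continuity_pt_comp clamp (fun t => t ^ n)); [apply continuity_pt_clamp | ].
  apply derivable_continuous_pt, derivable_pt_pow.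
Qed.

Lemma continuity_pt_dilog_comp h x : continuity_pt h x ->
  continuity_pt (fun t => dilog (clamp (h t))) x.
Proof.
intros Hh; apply (continuity_pt_comp h (fun y => dilog (clamp y))); auto.
apply continuity_pt_dilog_clamp.
Qed.

Lemma continuity_pt_vanish (f : R -> R) (C : R) :
  f 0 = 0 -> (forall x, Rabs x < 1 / 2 -> Rabs (f x) <= C * sqrt (Rabs x)) ->
  continuity_pt f 0.
Proof.
intros H0 Hb.
assert (HC : 0 <= C).
{ assert (H := Hb (1 / 4) ltac:(rewrite Rabs_pos_eq; lra)).
  assert (H1 := sqrt_lt_R0 (Rabs (1 / 4)) ltac:(rewrite Rabs_pos_eq; lra)).
  pose proof (Rabs_pos (f (1 / 4))); nra. }
intros eps Heps.
set (e := eps / (C + 1)).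
assert (He : 0 < e) by (apply Rdiv_lt_0_compat; lra).
assert (Ee : e * (C + 1) = eps) by (unfold e; field; lra).
exists (Rmin (1 / 2) (e * e)); split.
{ apply Rmin_glb_lt; nra. }
intros x [_ Hx]; simpl in *; unfold Rdist in *; rewrite H0, !Rminus_0_r in *.
assert (Hx1 : Rabs x < 1 / 2) by (apply Rlt_le_trans with (1 := Hx), Rmin_l).
assert (Hx2 : Rabs x < e * e) by (apply Rlt_le_trans with (1 := Hx), Rmin_r).
assert (Hs : sqrt (Rabs x) < e).
{ rewrite <- (sqrt_square e) by lra; apply sqrt_lt_1; auto; [apply Rabs_pos | nra]. }
specialize (Hb x Hx1); pose proof (sqrt_pos (Rabs x)); nra.
Qed.

Lemma ln_nonpos x : x <= 0 -> ln x = 0.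
Proof. intros Hx; unfold ln; destruct (Rlt_dec 0 x); [exfalso; lra | reflexivity]. Qed.

(** From [ln y <= y - 1] at [y = / sqrt x]. *)
Lemma x_ln_bound x : 0 < x <= 1 -> x * Rabs (ln x) <= 2 * sqrt x.
Proof.
intros Hx; assert (Hs := sqrt_lt_R0 x ltac:(lra)); assert (E := sqrt_sqrt x ltac:(lra)).
set (s := sqrt x) in *.
assert (H1 : ln (/ s) <= / s - 1).
{ assert (Hi : 0 < / s) by now apply Rinv_0_lt_compat.
  pose proof (exp_ineq1_le (ln (/ s))); rewrite exp_ln in H by auto; lra. }
rewrite ln_Rinv in H1 by auto.
assert (E2 : ln x = 2 * ln s) by (rewrite <- E, ln_mult by auto; ring).
assert (Hneg : ln x <= 0).
{ rewrite <- ln_1; destruct (Req_dec x 1) as [-> | Hx1]; [lra | left; apply ln_increasing; lra]. }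
rewrite Rabs_left1 by auto; rewrite E2, <- E.
assert (s * / s = 1) by (field; lra); nra.
Qed.

Lemma x_ln_bound_above (x y : R) : 0 < x < 1 / 2 -> x <= y <= 1 ->
  x * Rabs (ln y) <= 2 * sqrt x.
Proof.
intros Hx Hy; apply Rle_trans with (2 := x_ln_bound x ltac:(lra)).
apply Rmult_le_compat_l; [lra | ].
assert (H1 : ln x <= ln y) by (apply ln_le; lra).
assert (H2 : ln y <= 0) by (rewrite <- ln_1; apply ln_le; lra).
rewrite !Rabs_left1; lra.
Qed.

(** The reflection formula plus Landen's formula at [-x], simplified by the duplication
    formula [dilog x + dilog (-x) = dilog (x^2) / 2], which eliminates [dilog x] and
    [dilog (-x)].  The left side has derivative 0, and its limit at 0 is [dilog 1]. *)
Lemma dilog_three_terms x : 0 < x < 1 ->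
  / 2 * dilog (x ^ 2) + dilog (1 - x) + dilog (x / (1 + x)) + ln x * ln (1 - x)
  + / 2 * ln (1 + x) ^ 2 = PI ^ 2 / 6.
Proof.
intros Hx.
set (f := fun t => / 2 * dilog (clamp (t ^ 2)) + dilog (clamp (1 - t)) + dilog (clamp (t / (1 + t)))
                   + ln t * ln (1 - t) + / 2 * ln (1 + t) ^ 2).
assert (Hcl : forall t, 0 <= t < 1 ->
          clamp (t ^ 2) = t ^ 2 /\ clamp (1 - t) = 1 - t /\ clamp (t / (1 + t)) = t / (1 + t)).
{ intros t Ht; repeat split; apply clamp_id; try nra.
  assert (0 <= t / (1 + t)) by (apply Rmult_le_pos; [lra | left; apply Rinv_0_lt_compat; lra]).
  assert (t / (1 + t) * (1 + t) = t) by (field; lra); nra. }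
set (g := fun t => / 2 * dilog (t ^ 2) + dilog (1 - t) + dilog (t / (1 + t))
                   + ln t * ln (1 - t) + / 2 * ln (1 + t) ^ 2).
assert (Hfg : forall t, 0 <= t < 1 -> f t = g t).
{ intros t Ht; destruct (Hcl t Ht) as (E1 & E2 & E3); unfold f, g; now rewrite E1, E2, E3. }
assert (Hd : forall t, 0 < t < 1 -> is_derive g t 0).
{ intros t Ht.
  assert (H3 : 0 < t / (1 + t) < 1).
  { assert (0 < t / (1 + t)) by (apply Rdiv_lt_0_compat; lra).
    assert (t / (1 + t) * (1 + t) = t) by (field; lra); nra. }
  assert (D1 := is_derive_dilog (t ^ 2) ltac:(nra)).
  assert (D2 := is_derive_dilog (1 - t) ltac:(lra)).
  assert (D3 := is_derive_dilog (t / (1 + t)) H3).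
  replace (1 - (1 - t)) with t in D2 by ring.
  replace (1 - t / (1 + t)) with (/ (1 + t)) in D3 by (field; lra).
  rewrite ln_Rinv in D3 by lra.
  replace (1 - t ^ 2) with ((1 - t) * (1 + t)) in D1 by ring.
  rewrite ln_mult in D1 by lra.
  unfold g; revert D1 D2 D3; generalize dilog; intros P D1 D2 D3.
  auto_derive.
  - replace (t * (t * 1)) with (t ^ 2) by ring.
    repeat split; try lra; eexists; eassumption.
  - replace (t * (t * 1)) with (t ^ 2) by ring.
    change (1 + - t) with (1 - t); change (t * / (1 + t)) with (t / (1 + t)).
    assert (DP : forall y l, is_derive P y l -> Derive (fun x : R => P x) y = l)
      by (intros y l; apply is_derive_unique).
    rewrite (DP _ _ D1), (DP _ _ D2), (DP _ _ D3).
    field; lra. }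
assert (E : f x = f 0).
{ destruct (MVT_gen f 0 x (fun _ => 0)) as [c [_ Hc]];
    rewrite ?Rmin_left, ?Rmax_right in * by lra.
  - intros t Ht; apply (is_derive_ext_loc g); [ | apply Hd; lra].
    assert (Ht' : Rmin t (1 - t) > 0) by (apply Rmin_glb_lt; lra).
    exists (mkposreal _ Ht'); intros y Hy; symmetry; apply Hfg.
    change (Rabs (y - t) < Rmin t (1 - t)) in Hy; apply Rabs_def2 in Hy.
    pose proof (Rmin_l t (1 - t)); pose proof (Rmin_r t (1 - t)); lra.
  - intros t Ht.
    assert (Hlog : continuity_pt (fun t => ln t * ln (1 - t)) t).
    { destruct (Req_dec t 0) as [-> | Ht0].
      - apply continuity_pt_vanish with 4; [rewrite ln_nonpos, Rmult_0_l; lra | ].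
        intros y Hy; destruct (Rle_dec y 0) as [Hy0 | Hy0].
        + rewrite ln_nonpos, Rmult_0_l, Rabs_R0 by auto; pose proof (sqrt_pos (Rabs y)); lra.
        + assert (Hy1 : 0 < y < 1 / 2) by (rewrite Rabs_pos_eq in Hy; lra).
          rewrite (Rabs_pos_eq y) by lra.
          assert (H1 := x_ln_bound y ltac:(lra)).
          assert (H2 : Rabs (ln (1 - y)) <= 2 * y).
          { assert (ln (1 - y) <= 0) by (rewrite <- ln_1; apply ln_le; lra).
            rewrite Rabs_left1, <- ln_Rinv by lra.
            assert (Hi : 0 < / (1 - y)) by (apply Rinv_0_lt_compat; lra).
            assert (H3 := exp_ineq1_le (ln (/ (1 - y)))); rewrite exp_ln in H3 by auto.
            assert (/ (1 - y) * (1 - y) = 1) by (field; lra); nra. }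
          rewrite Rabs_mult; pose proof (Rabs_pos (ln y)); nra.
      - apply is_derive_continuity_pt with (/ t * ln (1 - t) - ln t / (1 - t)).
        auto_derive; [lra | change (1 + - t) with (1 - t); field; lra]. }
    unfold f; repeat apply continuity_pt_plus; auto.
    + apply continuity_pt_mult; [apply continuity_pt_const; now intros ? ? | ].
      apply continuity_pt_dilog_comp, is_derive_continuity_pt with (2 * t).
      auto_derive; auto; ring.
    + apply continuity_pt_dilog_comp, is_derive_continuity_pt with (- 1).
      auto_derive; auto; ring.
    + apply continuity_pt_dilog_comp, is_derive_continuity_pt with (/ (1 + t) ^ 2).
      auto_derive; [lra | field; lra].
    + apply is_derive_continuity_pt with (ln (1 + t) / (1 + t)).
      auto_derive; [lra | field; lra].
  - lra. }
rewrite (Hfg x ltac:(lra)), (Hfg 0 ltac:(lra)) in E; fold (g x); rewrite E; unfold g.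
assert (E0 : dilog 0 = 0) by (unfold dilog; rewrite PSeries_0; reflexivity).
replace (0 / (1 + 0)) with 0 by (unfold Rdiv; ring).
replace (1 + 0) with 1 by ring.
rewrite pow_i, Rminus_0_r, E0, dilog_1, ln_1 by lia; ring.
Qed.

Definition ln_phi : R := ln golden_ratio.

Lemma golden_ratio_eq : golden_ratio ^ 2 = golden_ratio + 1 /\ 1 < golden_ratio < 2.
Proof.
assert (E := sqrt_sqrt 5 ltac:(lra)); pose proof (sqrt_pos 5).
unfold golden_ratio; split; [simpl; nra | split; nra].
Qed.

Lemma golden_ratio_inv : / golden_ratio = golden_ratio - 1.
Proof.
destruct golden_ratio_eq as [E Hb].
apply Rmult_eq_reg_l with golden_ratio; [ | lra]; rewrite Rinv_r; lra.
Qed.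

(** At [x = / golden_ratio] the three arguments [x ^ 2], [1 - x] and [x / (1 + x)] coincide. *)
Lemma dilog_golden : dilog (2 - golden_ratio) = PI ^ 2 / 15 - ln_phi ^ 2.
Proof.
destruct golden_ratio_eq as [E Hb].
assert (H := dilog_three_terms (golden_ratio - 1) ltac:(lra)).
replace ((golden_ratio - 1) ^ 2) with (2 - golden_ratio) in H by (simpl in *; lra).
replace (1 - (golden_ratio - 1)) with (2 - golden_ratio) in H by ring.
replace (1 + (golden_ratio - 1)) with golden_ratio in H by ring.
replace ((golden_ratio - 1) / golden_ratio) with (2 - golden_ratio) in H
  by (apply Rmult_eq_reg_r with golden_ratio; [field_simplify; lra | lra]).
replace (ln (2 - golden_ratio)) with (- 2 * ln_phi) in H.
2:{ replace (2 - golden_ratio) with (/ golden_ratio * / golden_ratio)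
      by (rewrite golden_ratio_inv; lra).
    assert (0 < / golden_ratio) by (apply Rinv_0_lt_compat; lra).
    rewrite ln_mult, ln_Rinv by lra; unfold ln_phi; ring. }
rewrite <- golden_ratio_inv, ln_Rinv in H by lra; fold ln_phi in H; lra.
Qed.

Lemma exp_ln_phi : exp ln_phi = golden_ratio /\ exp (- ln_phi) = golden_ratio - 1.
Proof.
destruct golden_ratio_eq as [E Hb]; unfold ln_phi.
split; [apply exp_ln; lra | ].
rewrite exp_Ropp, exp_ln by lra; apply golden_ratio_inv.
Qed.

Lemma ln_phi_pos : 0 < ln_phi.
Proof.
destruct golden_ratio_eq as [E Hb]; unfold ln_phi; rewrite <- ln_1; apply ln_increasing; lra.
Qed.

Lemma sinh_ln_phi : sinh ln_phi = 1 / 2.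
Proof. destruct exp_ln_phi as [E1 E2]; unfold sinh; rewrite E1, E2; field. Qed.

Lemma cosh_ln_phi : cosh ln_phi = sqrt 5 / 2.
Proof. destruct exp_ln_phi as [E1 E2]; unfold cosh; rewrite E1, E2; unfold golden_ratio; field. Qed.

Lemma is_derive_sinh t : is_derive sinh t (cosh t).
Proof. unfold sinh, cosh; auto_derive; auto; field. Qed.

Lemma is_derive_cosh t : is_derive cosh t (sinh t).
Proof. unfold sinh, cosh; auto_derive; auto; field. Qed.

Lemma cosh_sqr t : cosh t ^ 2 = 1 + sinh t ^ 2.
Proof.
assert (E : exp t * exp (- t) = 1) by (rewrite <- exp_plus, Rplus_opp_r; apply exp_0).
unfold sinh, cosh.
transitivity (((exp t - exp (- t)) / 2) ^ 2 + exp t * exp (- t)); [field | rewrite E; ring].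
Qed.

Lemma cosh_pos t : 0 < cosh t.
Proof. unfold cosh; pose proof (exp_pos t); pose proof (exp_pos (- t)); lra. Qed.

Lemma sine_pair_hyperbolic : sine_pair (-1) sinh cosh ln_phi.
Proof.
pose proof ln_phi_pos; split; auto.
- apply is_derive_sinh.
- intros t; replace (- -1 * sinh t) with (sinh t) by ring; apply is_derive_cosh.
- intros t; rewrite cosh_sqr; ring.
- apply sinh_0.
- intros t _; apply cosh_pos.
- intros t Ht.
  assert (Hinc : forall a b, a < b -> sinh a < sinh b).
  { intros a b Hab; unfold sinh; assert (exp a < exp b) by now apply exp_increasing.
    assert (exp (- b) < exp (- a)) by (apply exp_increasing; lra); lra. }
  split; [rewrite <- sinh_0; apply Hinc; lra | ].
  apply Rlt_trans with (sinh ln_phi); [apply Hinc; lra | rewrite sinh_ln_phi; lra].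
Qed.

(** The function [t ln (1 - exp (-2t)) + t^2 / 2 - dilog (exp (-2t)) / 2] is a primitive of
    [t coth t].  It tends to [- dilog 1 / 2] at 0, and at [ln_phi] it is computed from
    [dilog_golden]. *)
Lemma coth_integral (X : R) :
  is_RInt (fun t => t * cosh t / sinh t) 0 ln_phi X -> X = PI ^ 2 / 20.
Proof.
intros HX; assert (HL := ln_phi_pos); assert (Hpair := sine_pair_hyperbolic).
set (f := fun t => t * ln (1 - exp (- 2 * t)) + t ^ 2 / 2
                   - / 2 * dilog (clamp (exp (- 2 * t)))).
assert (Hexp : forall t, 0 < t -> 0 < exp (- 2 * t) < 1).
{ intros t Ht; split; [apply exp_pos | rewrite <- exp_0; apply exp_increasing; lra]. }
assert (Hsinh : forall t, 0 < t -> 0 < sinh t).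
{ intros t Ht; unfold sinh; assert (exp (- t) < exp t) by (apply exp_increasing; lra); lra. }
rewrite (is_RInt_derive_open_left f (fun t => t * cosh t / sinh t) 0 ln_phi 2 X); auto.
- unfold f; rewrite Rmult_0_r, exp_0, (clamp_id 1), dilog_1 by lra.
  replace (- 2 * ln_phi) with (- ln_phi + - ln_phi) by ring.
  rewrite exp_plus, (proj2 exp_ln_phi).
  destruct golden_ratio_eq as [E Hb].
  replace ((golden_ratio - 1) * (golden_ratio - 1)) with (2 - golden_ratio) by (simpl in *; lra).
  rewrite clamp_id, dilog_golden by lra.
  replace (1 - (2 - golden_ratio)) with (golden_ratio - 1) by ring.
  rewrite <- golden_ratio_inv, ln_Rinv by lra; fold ln_phi; field.
- intros t Ht.
  set (g := fun t => t * ln (1 - exp (- 2 * t)) + t ^ 2 / 2 - / 2 * dilog (exp (- 2 * t))).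
  apply (is_derive_ext_loc g).
  { exists (mkposreal t (proj1 Ht)); intros y Hy.
    change (Rabs (y - t) < t) in Hy; apply Rabs_def2 in Hy.
    unfold f, g; rewrite clamp_id; auto; specialize (Hexp y ltac:(lra)); lra. }
  assert (He := Hexp t (proj1 Ht)); assert (Hs := Hsinh t (proj1 Ht)).
  assert (D := is_derive_dilog _ He).
  unfold g; revert D; generalize dilog; intros P D.
  auto_derive.
  + repeat split; try lra; eexists; eassumption.
  + change (1 + - exp (- 2 * t)) with (1 - exp (- 2 * t)).
    replace (Derive (fun x : R => P x) (exp (- 2 * t)))
      with (- ln (1 - exp (- 2 * t)) / exp (- 2 * t)) by (symmetry; apply is_derive_unique, D).
    assert (E1 : exp t * exp (- t) = 1) by (rewrite <- exp_plus, Rplus_opp_r; apply exp_0).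
    assert (E2 : exp (- 2 * t) = exp (- t) * exp (- t)) by (rewrite <- exp_plus; f_equal; ring).
    set (l := ln _).
    transitivity (t * (1 + exp (- 2 * t)) / (1 - exp (- 2 * t))).
    { field; lra. }
    rewrite E2 in *; unfold sinh, cosh in *.
    replace (1 + exp (- t) * exp (- t)) with ((exp t + exp (- t)) * exp (- t)) by (rewrite <- E1; ring).
    replace (1 - exp (- t) * exp (- t)) with ((exp t - exp (- t)) * exp (- t)) by (rewrite <- E1; ring).
    pose proof (exp_pos (- t)); field; lra.
- intros t Ht; apply (ex_derive_continuous (V := R_NormedModule)).
  assert (Hs := Hsinh t (proj1 Ht)); unfold sinh, cosh in *; auto_derive; lra.
- intros t Ht; assert (Hs := Hsinh t (proj1 Ht)).
  assert (H1 : t <= sinh t).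
  { destruct (MVT_gen sinh 0 t cosh) as [c [Hc E]];
      rewrite ?Rmin_left, ?Rmax_right in * by lra.
    - intros; apply is_derive_sinh.
    - intros; eapply is_derive_continuity_pt, is_derive_sinh.
    - rewrite sinh_0 in E; assert (1 <= cosh c); [ | nra].
      pose proof (cosh_sqr c); pose proof (cosh_pos c); pose proof (pow2_ge_0 (sinh c)); nra. }
  assert (H2 : cosh t <= 2).
  { pose proof (cosh_sqr t); pose proof (cosh_pos t).
    pose proof (sp_s _ _ _ _ Hpair t Ht); nra. }
  pose proof (cosh_pos t).
  assert (H3 : 0 <= t / sinh t <= 1).
  { split; [apply Rlt_le, Rdiv_lt_0_compat; lra | ].
    apply Rmult_le_reg_r with (sinh t); auto.
    unfold Rdiv; rewrite Rmult_assoc, Rinv_l; lra. }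
  replace (t * cosh t / sinh t) with (t / sinh t * cosh t) by (field; lra).
  rewrite Rabs_pos_eq; nra.
- assert (Hc : continuity_pt (fun t => t * ln (1 - exp (- 2 * t))) 0).
  { apply continuity_pt_vanish with 2; [ring | intros t Ht].
    destruct (Rle_dec t 0) as [Ht0 | Ht0].
    - assert (H1 := exp_ineq1_le (- 2 * t)).
      rewrite ln_nonpos, Rmult_0_r, Rabs_R0 by lra; pose proof (sqrt_pos (Rabs t)); lra.
    - assert (Ht1 : 0 < t < 1 / 2) by (rewrite Rabs_pos_eq in Ht; lra).
      rewrite Rabs_mult, (Rabs_pos_eq t) by lra; apply x_ln_bound_above; auto.
      assert (He := Hexp t (proj1 Ht1)).
      assert (H1 := exp_ineq1_le (2 * t)).
      assert (E1 : exp (2 * t) * exp (- 2 * t) = 1)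
        by (rewrite <- exp_plus; replace (2 * t + - 2 * t) with 0 by ring; apply exp_0).
      nra. }
  unfold f; apply continuity_pt_minus; [apply continuity_pt_plus; auto | ].
  + apply is_derive_continuity_pt with 0; auto_derive; auto; field.
  + apply continuity_pt_mult; [apply continuity_pt_const; now intros ? ? | ].
    apply continuity_pt_dilog_comp, is_derive_continuity_pt with (- 2).
    auto_derive; auto; rewrite Rmult_0_r, exp_0; ring.
Qed.

Lemma is_RInt_coth : is_RInt (fun t => t * cosh t / sinh t) 0 ln_phi (PI ^ 2 / 20).
Proof.
assert (Hp := sine_pair_hyperbolic).
destruct (is_RInt_sine_pair_series _ _ _ _ 0 Hp) as [_ HI].
assert (Hex : ex_RInt (fun t => t * cosh t / sinh t) 0 ln_phi).
{ eexists; eapply is_RInt_ext_open; [apply ln_phi_pos | | exact HI].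
  intros t Ht; pose proof (sp_s _ _ _ _ Hp t Ht); simpl; field; lra. }
destruct Hex as [X HX]; now rewrite <- (coth_integral X HX).
Qed.

(** * The three evaluations *)

(** The three integrals differ only in the point [z * s u ^ 2], which is 1, 1/2 or -1/4. *)
Lemma ellipticE_K_sqr_value z s c u (X V : R) (k : R -> R) :
  sine_pair z s c u -> 0 < s u -> -1 / 4 <= z * s u ^ 2 <= 1 ->
  is_RInt (fun t => t * c t / s t) 0 u X ->
  (forall x, 0 < x < 1 -> k x = (1 - sqrt (1 - z * s u ^ 2 * x)) / 2) ->
  V = PI ^ 2 * (X / (4 * s u) + (u * s u ^ 2 / 2 - z * (u - s u * c u) / 4) / (4 * s u ^ 3)) ->
  is_RInt (fun x => ellipticE (csqrt (1 - x)) * ellipticK (csqrt (k x)) ^ 2) 0 1 V.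
Proof.
intros Hp Hs Hz HX Hk ->.
rewrite <- (reduced_series _ _ _ _ _ Hp Hs HX).
generalize (is_RInt_ellipticE_K_sqr _ Hz).
apply is_RInt_ext_open; [lra | ]; intros x Hx; now rewrite Hk.
Qed.

Theorem corollary1 :
  is_RInt
    (fun x => ellipticE (csqrt (1 - x)) *
              ellipticK (csqrt ((1 - sqrt (1 - x)) / 2)) ^ 2)
    0 1 (PI ^ 3 * (1 + 4 * ln 2) / 32)
  /\
  is_RInt
    (fun x => ellipticE (csqrt (1 - x)) *
              ellipticK (csqrt (1 / 2 - 1 / 2 * sqrt (1 - x / 2))) ^ 2)
    0 1 (PI ^ 2 * (4 * catalanG + 2 + PI * ln 2) / (16 * sqrt 2))
  /\
  is_RInt
    (fun x => ellipticE (csqrt (1 - x)) *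
              ellipticK (csqrt (1 / 2 - sqrt (4 + x) / 4)) ^ 2)
    0 1 (PI ^ 2 / 2 *
         (PI ^ 2 / 20 + 3 * ln golden_ratio / 2 - sqrt 5 / 4)).
Proof.
pose proof PI_RGT_0; pose proof PI4_bounds.
destruct cot_integrals as [I2 I4].
assert (H2 := sqrt_lt_R0 2 ltac:(lra)); assert (E2 := sqrt_sqrt 2 ltac:(lra)).
repeat split.
- apply (ellipticE_K_sqr_value 1 sin cos (PI / 2) (PI / 2 * ln 2)); auto;
    rewrite ?sin_PI2, ?cos_PI2; try lra.
  + apply sine_pair_trig; lra.
  + intros x _; do 3 f_equal; ring.
- apply (ellipticE_K_sqr_value 1 sin cos (PI / 4) (catalanG / 2 + PI / 8 * ln 2)); auto;
    rewrite ?sin_PI4, ?cos_PI4.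
  + apply sine_pair_trig; lra.
  + apply Rdiv_lt_0_compat; lra.
  + replace (1 * (1 / sqrt 2) ^ 2) with (/ (sqrt 2 * sqrt 2)) by (field; lra).
    rewrite E2; lra.
  + intros x _.
    replace (1 * (1 / sqrt 2) ^ 2 * x) with (x / (sqrt 2 * sqrt 2)) by (field; lra).
    rewrite E2; field.
  + set (s := sqrt 2) in *.
    field_simplify_eq; [ | lra].
    replace (s ^ 4) with ((s * s) * (s * s)) by ring; replace (s ^ 2) with (s * s) by ring.
    rewrite E2; ring.
- assert (Hp := sine_pair_hyperbolic).
  apply (ellipticE_K_sqr_value (-1) sinh cosh ln_phi (PI ^ 2 / 20)); auto;
    rewrite ?sinh_ln_phi, ?cosh_ln_phi; try lra.
  + apply is_RInt_coth.
  + intros x Hx.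
    replace (1 - -1 * (1 / 2) ^ 2 * x) with ((4 + x) / (2 * 2)) by field.
    rewrite sqrt_div, sqrt_square by lra; field.
  + unfold ln_phi; field.
Qed.
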